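(* Let $J=\mathbb{N}$ or a finite initial section of $\mathbb{N}$, let $A$ be a bounded operator on $\ell^2(J)$ that is diagonal with respect to the standard basis, with eigenvalues $\{\lambda_j\}_{j\in J}$ (so $Ae_j=\lambda_je_j$), let $m\ge 1$ and let $a^1,\dots,a^m\in\ell^2(J)$. Then $\{A^na^i:\ n\in\mathbb{N}\cup\{0\},\ 1\le i\le m\}$ is a frame for $\ell^2(J)$ if and only if $\lambda_j\in\mathbb{D}$ for all $j\in J$ and the following two conditions hold: (a) There are a constant $C\ge1$, real numbers $d_j$ ($j\in J$) with $C^{-1}\le d_j\le C$, and complex numbers $\alpha^i_j$ ($j\in J$, $1\le i\le m$) with $\sum_{i=1}^m|\alpha^i_j|^2=1$ for all $j\in J$, such that $$a^i_j=d_j\,\overline{\alpha^i_j}\,(1-|\lambda_j|^2)^{1/2}\qquad\text{for all } j\in J,\ 1\le i\le m.$$ (b) The measure $\sum_{j}(1-|\lambda_j|^2)\delta_{\lambda_j}$ on $\mathbb{D}$ is Carleson, and for the numbers $\alpha^i_j$ in (a) there are $\eta\in(0,1)$ and $D_0>0$ such that, with $S=\{\lambda_j\}_{j\in J}$: (b1) for every $j\in J$, the ball $\Delta(\lambda_j,\eta)$ contains no more than $m$ points of $S$, counting repetitions; (b2) for every $j_1\in J$, if $\lambda_{j_1},\dots,\lambda_{j_p}$ ($p\le m$) are the points of $S$ in $\Delta(\lambda_{j_1},\eta)$, counting repetitions, then $$D_0^2\sum_{s=1}^p|c_{j_s}|^2\le\sum_{i=1}^m\Big|\sum_{s=1}^p\alpha^i_{j_s}c_{j_s}\Big|^2\qquad\text{for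 all }(c_{j_1},\dots,c_{j_p})\in\mathbb{C}^p,$$ where $D_0$ is one constant valid for all $j_1$.
   Context: $\mathbb{D}$ is the open unit disc and $H^2$ its Hardy space. The pseudo-hyperbolic metric is $\rho(z,w)=\left|\frac{z-w}{1-\overline{z}w}\right|$, and $\Delta(z,r)=\{w\in\mathbb{D}:\rho(z,w)<r\}$ for $0<r<1$. $\delta_\lambda$ is the unit point mass at $\lambda$. A positive measure $\mu$ on $\mathbb{D}$ is Carleson if there is a constant $C$ with $\int|f|^2d\mu\le C\|f\|^2$ for all $f\in H^2$. ''Counting repetitions'' means that the points of $S$ in a ball are counted by indices $j\in J$. A countable family $\{f_n\}$ in a Hilbert space $\mathcal{H}$ is a frame if there are constants $0<C_0\le C_1<\infty$ with $C_0\|f\|^2\le\sum_n|\langle f,f_n\rangle|^2\le C_1\|f\|^2$ for all $f\in\mathcal{H}$. *)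

(* Defs.v *)
From HB Require Import structures.
From mathcomp Require Import all_boot all_order all_algebra.
From mathcomp Require Import all_classical all_reals all_analysis.
From mathcomp Require Import complex ring.

Set Implicit Arguments.
Unset Strict Implicit.
Unset Printing Implicit Defensive.

Import Order.TTheory GRing.Theory Num.Theory.
Import numFieldNormedType.Exports.

Local Open Scope classical_set_scope.
Local Open Scope ring_scope.

(* The modulus as an element of [R]; the norm [`|z|] of [R[i]] lives in [R[i]]. *)
Notation cabs := ComplexField.Normc.normc.

Section ell2.
Context {R : realType} {I : choiceType}.

Definition sqsum (x : I -> R[i]^o) : \bar R :=
  (\esum_(j in [set: I]) (cabs (x j) ^+ 2)%:E)%E.

Definition ell2_pred : {pred (I -> R[i]^o)} := [pred x | (sqsum x < +oo)%E].

Lemma cabs_ge0 (z : R[i]) : 0 <= cabs z.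
Proof. by case: z => a b; exact: sqrtr_ge0. Qed.

Lemma cabs_sqrD (u v : R[i]) :
  cabs (u + v) ^+ 2 <= 2 * cabs u ^+ 2 + 2 * cabs v ^+ 2.
Proof.
case: u v => [a b] [c d] /=.
rewrite !sqr_sqrtr ?addr_ge0 ?sqr_ge0// -mulrDr -subr_ge0.
rewrite (_ : _ - _ = (a - c) ^+ 2 + (b - d) ^+ 2) ?addr_ge0 ?sqr_ge0//.
by ring.
Qed.

Lemma sqsum_le (c1 c2 : R) (x y z : I -> R[i]^o) : 0 <= c1 -> 0 <= c2 ->
  (forall j, cabs (z j) ^+ 2 <= c1 * cabs (x j) ^+ 2 + c2 * cabs (y j) ^+ 2) ->
  (sqsum z <= c1%:E * sqsum x + c2%:E * sqsum y)%E.
Proof.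
move=> c10 c20 zxy; apply: ge_ereal_sup => _ [X [finX _] <-].
apply: (@le_trans _ _ (c1%:E * (\sum_(j \in X) (cabs (x j) ^+ 2)%:E) +
    c2%:E * (\sum_(j \in X) (cabs (y j) ^+ 2)%:E))%E).
  rewrite !ge0_mule_fsumr; try by move=> *; rewrite lee_fin sqr_ge0.
  rewrite -fsbig_split//=; apply: lee_fsum => // j _.
  by rewrite -!EFinM -EFinD lee_fin.
apply: leeD; apply: lee_wpmul2l; rewrite ?lee_fin//.
  by apply: esum_ge; exists X.
by apply: esum_ge; exists X.
Qed.

Lemma ell2_submod_closed : submod_closed ell2_pred.
Proof.
split.
  by rewrite inE /sqsum esum1 ?ltry// => j _; rewrite Normc.normc0 expr0n.
move=> k x y; rewrite !inE => x2 y2.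
apply: (@le_lt_trans _ _
  ((2 * cabs k ^+ 2)%:E * sqsum x + 2%:E * sqsum y)%E).
  apply: sqsum_le => // [|j]; first by rewrite mulr_ge0// sqr_ge0.
  rewrite (le_trans (cabs_sqrD (k * x j) (y j)))//.
  by rewrite Normc.normcM exprMn mulrA.
rewrite lte_add_pinfty//; apply: lte_mul_pinfty => //.
by rewrite lee_fin mulr_ge0// sqr_ge0.
Qed.

HB.instance Definition _ :=
  GRing.isSubmodClosed.Build _ _ ell2_pred ell2_submod_closed.

End ell2.

Record ell2 (R : realType) (I : choiceType) :=
  Ell2 { ell2_fun :> I -> R[i]^o; _ : ell2_fun \in ell2_pred }.

Section ell2_type.
Context (R : realType) (I : choiceType).

HB.instance Definition _ := [isSub for @ell2_fun R I].
HB.instance Definition _ := [Choice of ell2 R I by <:].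
HB.instance Definition _ := [SubChoice_isSubLmodule of ell2 R I by <:].

End ell2_type.

Section ell2_hilbert.
Context {R : realType} {I : choiceType}.
Implicit Types x y : ell2 R I.

Definition l2norm x : R := Num.sqrt (fine (sqsum x)).

(* The sum of an absolutely summable family of reals, as the difference of the
   sums of its positive and negative parts. *)
Definition rsum (f : I -> R) : R :=
  fine (esum setT (EFin \o f)^\+ - esum setT (EFin \o f)^\-)%E.

Definition csum (f : I -> R[i]) : R[i] :=
  Complex (rsum (fun j => complex.Re (f j))) (rsum (fun j => complex.Im (f j))).

(* Linear in [x]; the family is absolutely summable by Cauchy-Schwarz. *)
Definition dot2 x y : R[i] := csum (fun j => x j * conjc (y j)).

Lemma ell2_basis_subproof (j : I) :
  (fun k => (k == j)%:R : R[i]^o) \in @ell2_pred R I.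
Proof.
rewrite inE /sqsum (esumID [set j])/=; last first.
  by move=> *; rewrite lee_fin sqr_ge0.
rewrite !setTI esum_set1 ?lee_fin ?sqr_ge0// esum1.
  by rewrite adde0 ltry.
by move=> k /eqP/negbTE ->; rewrite Normc.normc0 expr0n.
Qed.

Definition ell2_basis (j : I) : ell2 R I := Ell2 (ell2_basis_subproof j).

Definition bounded_op (A : ell2 R I -> ell2 R I) : Prop :=
  exists M : R, forall x, l2norm (A x) <= M * l2norm x.

Definition diagonal_op (A : ell2 R I -> ell2 R I) (lam : I -> R[i]) : Prop :=
  forall j, A (ell2_basis j) = lam j *: ell2_basis j.

(* Frames are indexed families: a vector occurring twice counts twice. *)
Definition is_frame (K : countType) (f : K -> ell2 R I) : Prop :=
  exists C0 C1 : R, [/\ 0 < C0, C0 <= C1 &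
    forall x : ell2 R I,
      ((C0 * l2norm x ^+ 2)%:E <=
         \esum_(k in [set: K]) (cabs (dot2 x (f k)) ^+ 2)%:E)%E /\
      (\esum_(k in [set: K]) (cabs (dot2 x (f k)) ^+ 2)%:E <=
         (C1 * l2norm x ^+ 2)%:E)%E].

End ell2_hilbert.

Section disc.
Context {R : realType}.

Definition disc : set R[i] := [set z | cabs z < 1].

Definition pseudo_hyp (z w : R[i]) : R := cabs ((z - w) / (1 - conjc z * w)).

Definition pseudo_ball (z : R[i]) (r : R) : set R[i] :=
  [set w | disc w /\ pseudo_hyp z w < r].

(* [f] restricted to the disc is the element of H^2 with Taylor coefficients
   [c]; its H^2 norm is [l2norm c].  Values of [f] off the disc are irrelevant. *)
Definition hardy2 (c : ell2 R nat) (f : R[i] -> R[i]) : Prop :=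
  forall z, disc z ->
    (series (fun n => c n * z ^+ n) : nat -> R[i]^o) @ \oo --> (f z : R[i]^o).

Definition borelC := g_sigma_algebraType (@open R[i]^o).

Definition carleson (mu : {measure set borelC -> \bar R}) : Prop :=
  exists C : R, forall (c : ell2 R nat) (f : R[i] -> R[i]), hardy2 c f ->
    (\int[mu]_(z in (disc : set borelC)) (cabs (f z) ^+ 2)%:E <=
       (C * l2norm c ^+ 2)%:E)%E.

End disc.
Arguments borelC : clear implicits.
Arguments disc : clear implicits.

Section atomic_measure.
Local Open Scope ereal_scope.
Context {R : realType} {I : choiceType} d (T : measurableType d).
Variables (w : I -> {nonneg R}) (x : I -> T).

Definition atomic (B : set T) : \bar R :=
  \esum_(i in [set: I]) ((w i)%:num%:E * \d_(x i) B).

Let atomic0 : atomic set0 = 0.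
Proof. by rewrite /atomic esum1// => i _; rewrite dirac0 mule0. Qed.

Let atomic_ge0 B : 0 <= atomic B.
Proof. by apply: esum_ge0 => i _; rewrite mule_ge0. Qed.

Let atomic_sigma_additive : semi_sigma_additive atomic.
Proof.
move=> F mF tF mUF.
rewrite (_ : atomic _ = \sum_(0 <= n <oo) atomic (F n)).
  by apply: is_cvg_nneseries => n _ _; exact: atomic_ge0.
rewrite nneseries_esumT; last by move=> n; exact: atomic_ge0.
transitivity (\esum_(i in [set: I]) \esum_(n in [set: nat])
    ((w i)%:num%:E * \d_(x i) (F n))).
  apply: eq_esum => i _; rewrite -nneseries_esumT; last first.
    by move=> n; rewrite mule_ge0.
  by rewrite nneseriesZl// measure_semi_bigcup.
rewrite esum_esum; last by move=> *; rewrite mule_ge0.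
rewrite esum_esum; last by move=> *; rewrite mule_ge0.
rewrite (reindex_esum ([set: nat] `*`` fun=> [set: I]) _
  (fun p : nat * I => (p.2, p.1)))//.
by split=> //= [[i n] [j p] _ _ [-> ->]//|[i n] _]; exists (n, i).
Qed.

HB.instance Definition _ := isMeasure.Build _ _ _ atomic
  atomic0 atomic_ge0 atomic_sigma_additive.

End atomic_measure.

Lemma disc_weight_subproof (R : realType) (z : R[i]) :
  0 <= Num.max 0 (1 - cabs z ^+ 2).
Proof. by rewrite le_max lexx. Qed.

(* The truncation at 0 only makes the weight nonnegative for arbitrary [z]; it
   has no effect when [z] is in the disc. *)
Definition disc_weight (R : realType) (z : R[i]) : {nonneg R} :=
  NngNum (disc_weight_subproof z).

Definition eigen_measure (R : realType) (I : choiceType) (lam : I -> R[i]) :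
    {measure set (borelC R) -> \bar R} :=
  atomic (fun j => disc_weight (lam j)) (lam : I -> borelC R).

(* Main.v *)
Require Import Defs.
From HB Require Import structures.
From mathcomp Require Import all_boot all_order all_algebra.
From mathcomp Require Import all_classical all_reals all_analysis.
From mathcomp Require Import complex ring lra finmap.

Set Implicit Arguments.
Unset Strict Implicit.
Unset Printing Implicit Defensive.

Import Order.TTheory GRing.Theory Num.Theory.
Import numFieldNormedType.Exports.

Local Open Scope classical_set_scope.
Local Open Scope ring_scope.
Local Open Scope complex_scope.

(** Let [K_j] be the normalised Szegő kernel at [lam j].  The coefficients of
    [x] against the orbit of [a i] are the Taylor coefficients of
    [sum_j x_j conj(a i j) / (1 - conj(lam j) z)].  Testing the frame
    inequalities on basis vectors forces every [lam j] into the disc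
    ([frame_disc]) and forces the normalisation (a) ([frame_normalisation]).
    Under (a) the frame inequalities say that the vectors [alpha_j (x) K_j]
    form a Riesz sequence in the Hardy space with values in [C^m] ([riesz],
    [riesz_of_frame], [frame_of_riesz]).  It remains to show that this Riesz
    property is equivalent to (b).

    The squared norm of a finite combination [sum_j z_j / (1 - conj(lam j) .)]
    has the closed form
    [Q(z) = sum_(j,k) z_j conj(z_k) / (1 - conj(lam j) lam k)], and the whole
    argument rests on two algebraic identities for [Q].  Multiplying [z_j] by
    the conjugate value at [lam j] of the Blaschke factor of a point [a] lowers
    [Q] by exactly [(1 - |a|^2) |sum_j z_j / (1 - a conj(lam j))|^2]
    ([szego_form_blaschke]).  With [v = (1 - |a|^2) / (1 - conj(a) .)] and
    multiplication again by conjugate values, one also has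
    [Q((1 - v/2) z) + Q(v z) / 4 <= Q(z)] ([szego_form_damp_le]).

    The upper Riesz bound is the adjoint form of the Carleson condition
    ([szego_form_bessel], [carleson_of_riesz]).

    Lower bound from (b), [vector_form_lower].  Let [W] be the sum of the forms
    [Q(alpha^i z)].  If [z] lives on the indices near [l], then (b2) applied to
    each Taylor coefficient bounds [W(z)] from below.  For arbitrary [z],
    multiply first by the Blaschke product of the points far from [l]: this
    does not increase [W], kills the far indices, and at [lam l] costs only a
    constant, because the far points are separated from [lam l] and the
    overlaps [|<K_j, K_l>|^2] have a bounded sum by the Carleson condition.
    Thus [W(z)] controls the single term of index [l].  To control all terms
    simultaneously, split off the bumps [v] of the points one by one, in order
    of decreasing modulus, the remaining part being multiplied by [1 - v/2].
    The accumulated damping at each point is again bounded below by the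
    Carleson condition.

    Local independence from the Riesz property,
    [local_condition_of_riesz].  By the Blaschke identity at [a = lam l], the
    form of a combination living near [l] is a rank-one term, which only sees
    the vectors [alpha_j], plus a form that is small because the Blaschke
    factor is small there.  So the Riesz lower bound passes to the [alpha_j];
    as [m + 1] vectors of [C^m] are dependent, at most [m] indices are near
    [l]. *)

(** * Squared moduli of complex numbers *)

Section modulus.
Context {R : realType}.
Implicit Types (z w a : R[i]) (t : R).

Lemma cabs_sqr z : cabs z ^+ 2 = complex.Re z ^+ 2 + complex.Im z ^+ 2.
Proof. by case: z => x y /=; rewrite sqr_sqrtr// addr_ge0// sqr_ge0. Qed.

Lemma cabs_sqrE z : (cabs z ^+ 2)%:C = z * conjc z.
Proof.
rewrite cabs_sqr; case: z => x y; apply/eqP; rewrite eq_complex /=.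
by apply/andP; split; apply/eqP; ring.
Qed.

Lemma conjcM z w : conjc (z * w) = conjc z * conjc w.
Proof. exact: rmorphM. Qed.

Lemma conjcB z w : conjc (z - w) = conjc z - conjc w.
Proof. exact: rmorphB. Qed.

Lemma conjcX z n : conjc (z ^+ n) = conjc z ^+ n.
Proof. exact: rmorphXn. Qed.

Lemma conjc_sum (I : Type) (s : seq I) (f : I -> R[i]) :
  conjc (\sum_(j <- s) f j) = \sum_(j <- s) conjc (f j).
Proof. exact: rmorph_sum. Qed.

Lemma cabsM z w : cabs (z * w) = cabs z * cabs w.
Proof. exact: Normc.normcM. Qed.

Lemma cabsV z : cabs z^-1 = (cabs z)^-1.
Proof. exact: Normc.normcV. Qed.

Lemma cabs0 : cabs (0 : R[i]) = 0. Proof. exact: Normc.normc0. Qed.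

Lemma cabs1 : cabs (1 : R[i]) = 1. Proof. exact: Normc.normc1. Qed.

Lemma cabsX z n : cabs (z ^+ n) = cabs z ^+ n.
Proof. by elim: n => [|n IHn]; rewrite ?expr0 ?cabs1// !exprS cabsM IHn. Qed.

Lemma cabs_eq0 z : (cabs z == 0) = (z == 0).
Proof.
by apply/eqP/eqP => [/Normc.eq0_normc//|->]; rewrite cabs0.
Qed.

Lemma cabs_conj z : cabs (conjc z) = cabs z.
Proof. by case: z => x y /=; rewrite sqrrN. Qed.

Lemma cabs_real t : cabs t%:C = `|t|.
Proof. by rewrite /= expr0n addr0 sqrtr_sqr. Qed.

Lemma le_cabsD z w : cabs (z + w) <= cabs z + cabs w.
Proof. exact: le_normcD. Qed.

Lemma cabsN z : cabs (- z) = cabs z. Proof. exact: normcN. Qed.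

Lemma le_Re_cabs z : `|complex.Re z| <= cabs z.
Proof.
by rewrite -ler_sqr ?nnegrE ?cabs_ge0// cabs_sqr real_normK ?num_real// lerDl sqr_ge0.
Qed.

Lemma le_Im_cabs z : `|complex.Im z| <= cabs z.
Proof.
by rewrite -ler_sqr ?nnegrE ?cabs_ge0// cabs_sqr real_normK ?num_real// lerDr sqr_ge0.
Qed.

Lemma cabs_sum (I : Type) (s : seq I) (f : I -> R[i]) :
  cabs (\sum_(j <- s) f j) <= \sum_(j <- s) cabs (f j).
Proof.
elim/big_ind2 : _ => [|x u y v ux vy|//]; first by rewrite cabs0.
by rewrite (le_trans (le_cabsD _ _))// lerD.
Qed.

Lemma cabs_sqr_sum (I : Type) (s : seq I) (f : I -> R[i]) :
  cabs (\sum_(j <- s) f j) ^+ 2 <= 2 ^+ size s * \sum_(j <- s) cabs (f j) ^+ 2.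
Proof.
elim: s => [|j s IHs]; first by rewrite !big_nil cabs0 expr0n mulr0.
rewrite !big_cons /= (le_trans (cabs_sqrD _ _))//.
have p1 : 1 <= 2 ^+ size s :> R by rewrite exprn_ege1// ler1n.
have := sqr_ge0 (cabs (f j)); move: (cabs (f j) ^+ 2) => X X0.
rewrite (exprS 2) -mulrA mulrDr -[leLHS]mulrDr ler_pM2l// lerD//.
by rewrite ler_peMl.
Qed.

Lemma young_ineq (x y t : R) : 0 < t -> x * y <= (t * x ^+ 2 + t^-1 * y ^+ 2) / 2.
Proof.
move=> t0; rewrite -subr_ge0.
rewrite (_ : _ - _ = t^-1 / 2 * (t * x - y) ^+ 2); last first.
  by field; rewrite gt_eqF.
by rewrite mulr_ge0 ?sqr_ge0// divr_ge0// invr_ge0 ltW.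
Qed.

Lemma young_sum (I : Type) (s : seq I) (x y : I -> R[i]) t : 0 < t ->
  cabs (\sum_(j <- s) x j * y j) <=
  (t * (\sum_(j <- s) cabs (x j) ^+ 2) +
   t^-1 * (\sum_(j <- s) cabs (y j) ^+ 2)) / 2.
Proof.
move=> t0; rewrite (le_trans (cabs_sum _ _))// !mulr_sumr -big_split/= mulr_suml.
by apply: ler_sum => j _; rewrite cabsM young_ineq.
Qed.

Lemma discE z : disc R z = (cabs z ^+ 2 < 1) :> Prop.
Proof.
rewrite /disc /=; apply/propext; split; first by move=> z1; rewrite expr_lt1 ?cabs_ge0.
by rewrite expr_lt1 ?cabs_ge0.
Qed.

Lemma disc0 : disc R 0. Proof. by rewrite /disc /mkset cabs0. Qed.

Lemma disc_sub_gt0 z : disc R z -> 0 < 1 - cabs z ^+ 2.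
Proof. by rewrite discE subr_gt0. Qed.

Lemma disc_sub_ge0 z : disc R z -> 0 <= 1 - cabs z ^+ 2.
Proof. by move=> /disc_sub_gt0/ltW. Qed.

Lemma cabs_conjM_lt1 a z : disc R a -> disc R z -> cabs (conjc a * z) < 1.
Proof. by move=> a1 z1; rewrite cabsM cabs_conj mulr_ilt1 ?cabs_ge0. Qed.

Lemma sub1_neq0 z : cabs z < 1 -> 1 - z != 0.
Proof. by apply: contraTneq => /eqP; rewrite subr_eq0 => /eqP <-; rewrite cabs1 ltxx. Qed.

Lemma szego_den_neq0 a z : disc R a -> disc R z -> 1 - conjc a * z != 0.
Proof. by move=> a1 z1; rewrite sub1_neq0// cabs_conjM_lt1. Qed.

(** The squared modulus of the inner product of the normalised Szegő kernels
    at [a] and [z]. *)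
Definition overlap a z : R :=
  (1 - cabs a ^+ 2) * (1 - cabs z ^+ 2) / cabs (1 - conjc a * z) ^+ 2.

Lemma overlap_ge0 a z : disc R a -> disc R z -> 0 <= overlap a z.
Proof.
move=> /disc_sub_gt0 a1 /disc_sub_gt0 z1.
by rewrite /overlap divr_ge0 ?sqr_ge0// mulr_ge0// ltW.
Qed.

Lemma pseudo_hyp_sqr a z : disc R a -> disc R z ->
  pseudo_hyp a z ^+ 2 = 1 - overlap a z.
Proof.
move=> a1 z1; have := szego_den_neq0 a1 z1; rewrite -cabs_eq0 -sqrf_eq0 => n0.
rewrite /pseudo_hyp /overlap cabsM cabsV exprMn exprVn.
apply: (mulIf n0); rewrite mulfVK// mulrBl mul1r mulfVK//.
by rewrite !cabs_sqr; case: a z {a1 z1 n0} => [a b] [c d] /=; ring.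
Qed.

Lemma pseudo_hyp_ge0 a z : 0 <= pseudo_hyp a z.
Proof. exact: cabs_ge0. Qed.

Lemma pseudo_hypC a z : pseudo_hyp a z = pseudo_hyp z a.
Proof.
rewrite /pseudo_hyp !cabsM !cabsV -opprB cabsN -(cabs_conj (1 - _)).
by rewrite conjcB conjcM conjc1 conjcK [a * _]mulrC.
Qed.

End modulus.

(** * Quadratic forms of the Szegő kernel on finite sets of points *)

Lemma cvg_finite_sum (R : realType) (I : Type) (s : seq I)
    (f : I -> nat -> R) (l : I -> R) :
  (forall j, f j @ \oo --> l j) ->
  (fun n => \sum_(j <- s) f j n) @ \oo --> \sum_(j <- s) l j.
Proof. by move=> fl; apply: cvg_big => [|j _]; [exact: add_continuous|exact: fl]. Qed.

Section szego.
Context {R : realType} {I : choiceType} (lam : I -> R[i]).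
Hypothesis lam_disc : forall j, disc R (lam j).
Implicit Types (s : seq I) (z w : I -> R[i]) (a : R[i]).

(** The squared norm in the Hardy space of the combination with coefficients
    [z] of the Szegő kernels at the points [lam j]. *)
Definition szego s z : R[i] :=
  \sum_(j <- s) \sum_(k <- s)
    z j * conjc (z k) / (1 - conjc (lam j) * lam k).

Definition szego_form s z : R := complex.Re (szego s z).

(** The conjugate of the value at [lam j] of the Blaschke factor of [a]:
    multiplying coefficients by it is the action on kernels of the adjoint of
    the multiplication operator. *)
Definition blaschke a j : R[i] :=
  (conjc (lam j) - conjc a) / (1 - a * conjc (lam j)).

(** The conjugate of the value at [lam j] of the Szegő kernel at [a], scaled to
    be one at [a]. *)
Definition kernel_bump a j : R[i] := (1 - cabs a ^+ 2)%:C / (1 - a * conjc (lam j)).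

Definition damp a j : R[i] := 1 - kernel_bump a j / 2.

Let den_neq0 a j : disc R a -> 1 - a * conjc (lam j) != 0.
Proof.
move=> a1; rewrite mulrC.
by apply: szego_den_neq0.
Qed.

Let conj_den a j : conjc (1 - a * conjc (lam j)) = 1 - conjc a * lam j.
Proof. by rewrite conjcB conjcM conjc1 conjcK. Qed.

Lemma eq_szego_form s z w : {in s, z =1 w} -> szego_form s z = szego_form s w.
Proof.
move=> zw; congr complex.Re; apply: eq_big_seq => j js.
by apply: eq_big_seq => k ks; rewrite !zw.
Qed.

Lemma mulr_sum_conj s z :
  (\sum_(j <- s) z j) * conjc (\sum_(j <- s) z j) =
  \sum_(j <- s) \sum_(k <- s) z j * conjc (z k) :> R[i].
Proof.
rewrite conjc_sum mulr_suml; apply: eq_bigr => j _.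
by rewrite mulr_sumr.
Qed.

Let ReZ (t : R) (x : R[i]) : complex.Re (t%:C * x) = t * complex.Re x.
Proof. by case: x => x y /=; rewrite mul0r subr0. Qed.

Let ReD (x y : R[i]) : complex.Re (x + y) = complex.Re x + complex.Re y.
Proof. by case: x y => ? ? []. Qed.

(** The kernel [(1 - conj(b w) b z) / (1 - conj w z)], with [b] the Blaschke
    factor of [a], is the rank-one kernel of the model space of [b]. *)
Lemma szego_form_blaschke a s z : disc R a ->
  szego_form s z = szego_form s (fun j => blaschke a j * z j) +
    (1 - cabs a ^+ 2) * cabs (\sum_(j <- s) z j / (1 - a * conjc (lam j))) ^+ 2.
Proof.
move=> a1; rewrite -[cabs (\sum_(j <- s) _) ^+ 2]/(complex.Re (cabs _ ^+ 2)%:C).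
rewrite -ReZ -ReD cabs_sqrE mulr_sum_conj; congr complex.Re.
rewrite mulr_sumr -big_split; apply: eq_bigr => j _.
rewrite mulr_sumr -big_split; apply: eq_bigr => k _ /=.
have -> : (1 - cabs a ^+ 2)%:C = 1 - a * conjc a.
  by rewrite -cabs_sqrE rmorphB rmorph1.
rewrite /blaschke !conjcM conjc_inv conj_den conjcB !conjcK.
have h1 := den_neq0 j a1; have h2 := den_neq0 k a1.
have h3 : 1 - conjc a * lam k != 0.
  by rewrite -conj_den conjc_eq0.
have h4 := szego_den_neq0 (lam_disc j) (lam_disc k).
by field; rewrite h1 h3 h4.
Qed.

(** With [v] the scaled kernel, [v z + conj(v w) - v z conj(v w)] divided by
    [1 - conj w z] is a positive multiple of the Szegő kernel plus a rank-one
    term. *)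
Let szego_damp a s z : disc R a ->
  szego s z = szego s (fun j => damp a j * z j) +
    4^-1%:C * szego s (fun j => kernel_bump a j * z j) +
    (((1 - cabs a ^+ 2) / 2)%:C * szego s z +
     (cabs a ^+ 2 / (2 * (1 - cabs a ^+ 2)))%:C *
     (cabs (\sum_(j <- s) kernel_bump a j * z j) ^+ 2)%:C).
Proof.
move=> a1; rewrite cabs_sqrE mulr_sum_conj.
rewrite !mulr_sumr -!big_split; apply: eq_bigr => j _.
rewrite /= !mulr_sumr -!big_split; apply: eq_bigr => k _ /=.
have h0 : (1 - cabs a ^+ 2)%:C != 0 :> R[i].
  by rewrite fmorph_eq0 gt_eqF// disc_sub_gt0.
have h1 := den_neq0 j a1; have h2 := den_neq0 k a1.
have h3 : 1 - conjc a * lam k != 0.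
  by rewrite -conj_den conjc_eq0.
have h4 := szego_den_neq0 (lam_disc j) (lam_disc k).
rewrite /damp /kernel_bump; move: (cabs_sqrE a) h0.
move: (cabs a ^+ 2) => t ta h0.
rewrite !conjcM !conjcB !conjcM !conjc_inv !conj_den conjc1 conjc_nat conjc_real.
have e1 : (1 - t)%:C = 1 - a * conjc a by rewrite rmorphB rmorph1 -ta.
have e2 : ((1 - t) / 2)%:C = (1 - a * conjc a) / 2.
  by rewrite rmorphM fmorphV rmorph_nat -e1.
have e3 : (4^-1 : R)%:C = 4^-1 by rewrite fmorphV rmorph_nat.
have e4 : (t / (2 * (1 - t)))%:C = a * conjc a / (2 * (1 - a * conjc a)).
  by rewrite rmorphM fmorphV (rmorphM _ 2) rmorph_nat -e1 -ta.
rewrite e2 e3 e4 e1; rewrite e1 in h0.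
by field; rewrite h0 h1 h3 h4.
Qed.

(** The Blaschke identity at the origin telescopes along the Taylor
    coefficients of the combination of Szegő kernels. *)
Lemma szego_form_telescope s z N :
  series (fun n => cabs (\sum_(j <- s) z j * conjc (lam j) ^+ n) ^+ 2) N =
  szego_form s z - szego_form s (fun j => conjc (lam j) ^+ N * z j).
Proof.
elim: N => [|N IHN].
  rewrite /series /= big_geq//; apply/esym/eqP; rewrite subr_eq0; apply/eqP.
  by apply: eq_szego_form => j _; rewrite expr0 mul1r.
rewrite seriesSr IHN (szego_form_blaschke s (fun j => conjc (lam j) ^+ N * z j) (@disc0 R)).
rewrite cabs0 expr0n subr0 mul1r opprD addrA.
rewrite (_ : \sum_(j <- s) _ = \sum_(j <- s) z j * conjc (lam j) ^+ N); last first.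
  by apply: eq_bigr => j _; rewrite mul0r subr0 divr1 mulrC.
rewrite subrK; congr (_ - _); apply: eq_szego_form => j _.
by rewrite /blaschke conjc0 mul0r !subr0 divr1 mulrA exprS.
Qed.

Let cvg_geometric_term (c u : R[i]) : cabs u < 1 ->
  (fun n => complex.Re (c * u ^+ n)) @ \oo --> (0 : R).
Proof.
move=> u1.
have h : (fun n => cabs c * cabs u ^+ n) @ \oo --> (0 : R).
  rewrite -(mulr0 (cabs c)); apply: cvgMr.
  by apply: cvg_expr; rewrite ger0_norm// cabs_ge0.
apply/norm_cvg0P; apply: squeeze_cvgr (cvg_cst _) h; near=> n.
by rewrite normr_ge0/= (le_trans (le_Re_cabs _))// cabsM cabsX.
Unshelve. all: by end_near. Qed.

Lemma cvg_szego_form s z :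
  series (fun n => cabs (\sum_(j <- s) z j * conjc (lam j) ^+ n) ^+ 2) @ \oo -->
  szego_form s z.
Proof.
rewrite (funext (szego_form_telescope s z)).
rewrite -[X in _ --> X]subr0; apply: cvgB; first exact: cvg_cst.
rewrite /szego_form /szego.
rewrite (_ : (fun N => _) = (fun N => \sum_(j <- s) \sum_(k <- s)
   complex.Re (z j * conjc (z k) / (1 - conjc (lam j) * lam k) *
     (conjc (lam j) * lam k) ^+ N))); last first.
  apply/funext => N.
  rewrite (big_morph _ ReD (erefl : complex.Re 0 = 0)); apply: eq_bigr => j _.
  rewrite (big_morph _ ReD (erefl : complex.Re 0 = 0)); apply: eq_bigr => k _.
  congr complex.Re; rewrite conjcM conjcX conjcK exprMn.
  by ring.
rewrite [X in _ --> X](_ : 0 = \sum_(j <- s) \sum_(k <- s) (0 : R)); last first.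
  by rewrite big1// => j _; rewrite big1.
apply: cvg_finite_sum => j; apply: cvg_finite_sum => k; apply: cvg_geometric_term.
exact: cabs_conjM_lt1.
Qed.

(** Positivity is read off from the expansion in Taylor coefficients. *)
Lemma szego_form_ge0 s z : 0 <= szego_form s z.
Proof.
apply: (ler_cvg_to (cvg_cst 0) (cvg_szego_form (s := s) (z := z))).
by apply: nearW => N; rewrite /series /= sumr_ge0// => n _; exact: sqr_ge0.
Qed.

Lemma szego_form_damp_le a s z : disc R a ->
  szego_form s (fun j => damp a j * z j) +
    4^-1 * szego_form s (fun j => kernel_bump a j * z j) <= szego_form s z.
Proof.
move=> a1; have w0 := disc_sub_gt0 a1.
rewrite [leRHS]/szego_form (szego_damp _ _ a1) 3!ReD !ReZ.
rewrite /szego_form lerDl; apply: addr_ge0; apply: mulr_ge0.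
- by rewrite divr_ge0// ltW.
- exact: szego_form_ge0.
- by rewrite divr_ge0 ?sqr_ge0// mulr_ge0// ltW.
- exact: sqr_ge0.
Qed.

Lemma szego_form_blaschke_le a s z : disc R a ->
  szego_form s (fun j => blaschke a j * z j) <= szego_form s z.
Proof.
move=> a1; rewrite [leRHS](szego_form_blaschke _ _ a1) lerDl.
by rewrite mulr_ge0 ?sqr_ge0// ltW// disc_sub_gt0.
Qed.

Lemma szego_form1 j z :
  szego_form [:: j] z = cabs (z j) ^+ 2 / (1 - cabs (lam j) ^+ 2).
Proof.
rewrite /szego_form /szego !big_seq1 -cabs_sqrE [conjc _ * _]mulrC -cabs_sqrE.
by rewrite -[1 in LHS](rmorph1 (real_complex R)) -rmorphB -fmorphV -rmorphM.
Qed.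

Lemma szego_form_le_diag s z :
  szego_form s z <=
  2 ^+ size s * \sum_(j <- s) cabs (z j) ^+ 2 / (1 - cabs (lam j) ^+ 2).
Proof.
pose F j n := cabs (\sum_(k <- [:: j]) z k * conjc (lam k) ^+ n) ^+ 2.
have cF : (fun N => 2 ^+ size s * \sum_(j <- s) series (F j) N) @ \oo -->
    2 ^+ size s * \sum_(j <- s) cabs (z j) ^+ 2 / (1 - cabs (lam j) ^+ 2).
  apply: cvgMr; apply: cvg_finite_sum => j.
  by rewrite -szego_form1; exact: cvg_szego_form.
apply: (ler_cvg_to (cvg_szego_form (s := s) (z := z)) cF); apply: nearW => N.
rewrite /series /= exchange_big mulr_sumr; apply: ler_sum => n _ /=.
rewrite /F; under [X in _ <= _ * X]eq_bigr do rewrite big_seq1.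
exact: cabs_sqr_sum.
Qed.

Lemma cabs_blaschke a j : disc R a ->
  cabs (blaschke a j) ^+ 2 = 1 - overlap a (lam j).
Proof.
move=> a1; rewrite -pseudo_hyp_sqr// pseudo_hypC /pseudo_hyp /blaschke -conjcB.
by rewrite !cabsM cabs_conj [a * _]mulrC.
Qed.

End szego.

(** * A lower bound from local independence *)

Section exponential_bounds.
Context {R : realType}.

Lemma prod_ge_expR (I : eqType) (r : seq I) (t f : I -> R) :
  (forall k, k \in r -> expR (- t k) <= f k) ->
  expR (- \sum_(k <- r) t k) <= \prod_(k <- r) f k.
Proof.
elim: r => [|k r IHr] tf; first by rewrite !big_nil oppr0 expR0.
rewrite !big_cons opprD expRD ler_pM ?expR_ge0//; first exact/tf/mem_head.
by apply: IHr => l lr; apply: tf; rewrite inE lr orbT.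
Qed.

(** Turns a lower bound on a squared pseudo-hyperbolic distance [1 - x] into an
    exponential one, so that products of distances are bounded through sums of
    overlaps. *)
Lemma expRN_le_sub (x c : R) : 0 < c -> c <= 1 - x -> 0 <= x ->
  expR (- (x / c)) <= 1 - x.
Proof.
move=> c0 cx x0; have y0 : 0 < 1 - x by exact: lt_le_trans cx.
rewrite expRN -[leRHS]invrK lef_pV2 ?posrE ?expR_gt0 ?invr_gt0//.
apply: le_trans (expR_ge1Dx _).
rewrite (_ : (1 - x)^-1 = 1 + x / (1 - x)); last by field; rewrite gt_eqF.
by rewrite lerD2l ler_wpM2l// lef_pV2 ?posrE.
Qed.

Lemma expRN_le_sub_sqr (u : R) : 0 <= u <= 1 ->
  expR (- (2 * u)) <= (1 - u / 2) ^+ 2.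
Proof.
move=> /andP[u0 u1]; rewrite -mulrN expRM_natl.
rewrite ler_sqr ?nnegrE ?expR_ge0//; last by lra.
rewrite expRN -[leRHS]invrK lef_pV2 ?posrE ?expR_gt0 ?invr_gt0//; last lra.
apply: le_trans (expR_ge1Dx _).
have d0 : 0 < 1 - u / 2 by lra.
by rewrite -div1r ler_pdivrMr//; nra.
Qed.

End exponential_bounds.

Section damping.
Context {R : realType} {I : choiceType} (lam : I -> R[i]).
Hypothesis lam_disc : forall j, disc R (lam j).

(** Twice the real part of a bump is a Poisson-type kernel plus the constant
    [1 - |a|^2].  That kernel is comparable to the overlap only when the point
    [a] is the one closer to the circle, which is why the damping factors are
    used in order of decreasing modulus. *)
Lemma damp_lower a j : disc R a -> cabs (lam j) <= cabs a ->
  expR (- ((1 - cabs a ^+ 2) + 2 * overlap a (lam j))) <=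
  cabs (damp lam a j) ^+ 2.
Proof.
move=> a1 ja; have A0 := disc_sub_gt0 a1; have l1 := lam_disc j.
set A := 1 - cabs a ^+ 2 in A0 *.
set w := a * conjc (lam j).
have cw : cabs w = cabs a * cabs (lam j) by rewrite cabsM cabs_conj.
have cw1 : cabs w < 1.
  by rewrite cw mulr_ilt1 ?cabs_ge0.
have d0 : 0 < cabs (1 - w) ^+ 2.
  rewrite lt0r sqr_ge0 andbT sqrf_eq0 cabs_eq0; exact: sub1_neq0.
set u := complex.Re (kernel_bump lam a j).
(* Comes from [2 Re (1 - w) = |1 - w|^2 + 1 - |w|^2]. *)
have uE : 2 * u = A + A * (1 - cabs w ^+ 2) / cabs (1 - w) ^+ 2.
  rewrite /u /kernel_bump -/A -/w.
  have -> : complex.Re (A%:C / (1 - w)) = A * complex.Re (1 - w) / cabs (1 - w) ^+ 2.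
    rewrite cabs_sqr; case: w {cw cw1 d0} => x y /=; ring.
  have -> : cabs w ^+ 2 = cabs (1 - w) ^+ 2 - 2 * complex.Re (1 - w) + 1.
    by rewrite !cabs_sqr; case: w {cw cw1 d0} => x y /=; ring.
  by field; rewrite -sqrf_eq0 gt_eqF.
have u0 : 0 <= u.
  rewrite -(pmulr_rge0 _ (ltr0n R 2)) uE addr_ge0 //; first exact: ltW.
  by rewrite divr_ge0 ?sqr_ge0// mulr_ge0 ?(ltW A0)// subr_ge0 expr_le1 ?cabs_ge0 ?ltW.
(* [lam j] is at most as far out as [a], so [|1 - w| >= 1 - |a|^2]. *)
have u1 : u <= 1.
  rewrite (le_trans (ler_norm _))// (le_trans (le_Re_cabs _))//.
  rewrite /kernel_bump cabsM cabsV cabs_real -/A ger0_norm ?(ltW A0)// -/w.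
  rewrite ler_pdivrMr ?mul1r; last first.
    by rewrite lt0r cabs_eq0 cabs_ge0 sub1_neq0.
  have : 1 <= cabs (1 - w) + cabs w.
    by rewrite -[leLHS](@cabs1 R) (le_trans _ (le_cabsD _ _))// subrK.
  rewrite /A; have : cabs w <= cabs a ^+ 2.
    by rewrite cw expr2 ler_wpM2l ?cabs_ge0.
  lra.
have u2 : 2 * u <= A + 2 * overlap a (lam j).
  rewrite uE lerD2l /overlap -/A.
  have -> : cabs (1 - conjc a * lam j) = cabs (1 - w).
    by rewrite -cabs_conj conjcB conjcM conjc1 conjcK.
  rewrite mulrA ler_pM2r ?invr_gt0// mulrCA ler_pM2l//.
  rewrite cw exprMn.
  have h1 : cabs (lam j) ^+ 2 <= cabs a ^+ 2 by rewrite ler_sqr ?nnegrE ?cabs_ge0.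
  have h2 := sqr_ge0 (cabs (lam j)).
  move: h1 h2; move: (cabs (lam j) ^+ 2) (cabs a ^+ 2) => y x yx y0.
  have := ler_wpM2r y0 yx; have := sqr_ge0 (1 - y). nra.
apply: (@le_trans _ _ (expR (- (2 * u)))); first by rewrite ler_expR lerN2.
apply: le_trans (expRN_le_sub_sqr _) _; first by rewrite u0.
rewrite cabs_sqr /damp -[leLHS]addr0 lerD ?sqr_ge0//.
rewrite (_ : complex.Re _ = 1 - u / 2)//.
rewrite /u; case: (kernel_bump lam a j) => x y /=.
by field.
Qed.

End damping.

Section lower_bound.
Context {R : realType} {I : choiceType} (lam : I -> R[i]).
Hypothesis lam_disc : forall j, disc R (lam j).
Context (m : nat) (alpha : 'I_m -> I -> R[i]) (s : seq I) (eta D K : R).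
Hypotheses (eta_gt0 : 0 < eta) (D_gt0 : 0 < D).

Hypothesis local_independence : forall l (w : I -> R[i]), l \in s ->
  (forall j, j \in s -> eta <= pseudo_hyp (lam l) (lam j) -> w j = 0) ->
  D * \sum_(j <- s) cabs (w j) ^+ 2 <=
  \sum_(i < m) cabs (\sum_(j <- s) alpha i j * w j) ^+ 2.

Hypothesis sum_overlap : forall l, l \in s ->
  \sum_(j <- s) overlap (lam j) (lam l) <= K.

Hypothesis sum_weight : \sum_(j <- s) (1 - cabs (lam j) ^+ 2) <= K.

Implicit Types z w : I -> R[i].

(** The squared norm of the combination with coefficients [z] of the vectors
    [alpha j] tensored with the Szegő kernels at the points [lam j]. *)
Definition vector_form z : R :=
  \sum_(i < m) szego_form lam s (fun j => alpha i j * z j).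

Let eq_vector_form z w : {in s, z =1 w} -> vector_form z = vector_form w.
Proof.
move=> zw; apply: eq_bigr => i _; apply: eq_szego_form => j js.
by rewrite zw.
Qed.

(** For a combination living near one point the local hypothesis applies to
    each Taylor coefficient separately. *)
Lemma vector_form_local l w : l \in s ->
  (forall j, j \in s -> eta <= pseudo_hyp (lam l) (lam j) -> w j = 0) ->
  D * \sum_(j <- s) cabs (w j) ^+ 2 / (1 - cabs (lam j) ^+ 2) <= vector_form w.
Proof.
move=> ls w0.
pose F j n := cabs (\sum_(k <- [:: j]) w k * conjc (lam k) ^+ n) ^+ 2.
pose G i n := cabs (\sum_(j <- s) alpha i j * w j * conjc (lam j) ^+ n) ^+ 2.
have cF : (fun N => D * \sum_(j <- s) series (F j) N) @ \oo -->
    D * \sum_(j <- s) cabs (w j) ^+ 2 / (1 - cabs (lam j) ^+ 2).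
  apply: cvgMr; apply: cvg_finite_sum => j.
  by rewrite -szego_form1; exact: cvg_szego_form.
have cG : (fun N => \sum_(i < m) series (G i) N) @ \oo --> vector_form w.
  by apply: cvg_finite_sum => i; exact: cvg_szego_form.
apply: (ler_cvg_to cF cG); apply: nearW => N.
rewrite /series /= exchange_big [leRHS]exchange_big mulr_sumr /=.
apply: ler_sum => n _; rewrite /F /G.
under eq_bigr do rewrite big_seq1.
under [leRHS]eq_bigr do under eq_bigr do rewrite -mulrA.
by apply: local_independence ls _ => j js jl; rewrite w0// mul0r.
Qed.

Lemma vector_form_blaschke (r : seq I) w :
  vector_form (fun j => \prod_(k <- r) blaschke lam (lam k) j * w j) <=
  vector_form w.
Proof.
elim: r => [|k r IHr].
  by under eq_vector_form do rewrite big_nil mul1r.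
apply: le_trans IHr; apply: ler_sum => i _.
apply: le_trans (szego_form_blaschke_le _ _ _ (lam_disc k)) => //.
rewrite le_eqVlt; apply/orP; left; apply/eqP; apply: eq_szego_form => j _.
by rewrite big_cons; ring.
Qed.

(** Multiplying by the Blaschke product of the far points reduces to the local
    case; its value at [lam l] is controlled by the sum of the overlaps. *)
Lemma vector_form_point l w : l \in s ->
  D * expR (- (K / eta ^+ 2)) * (cabs (w l) ^+ 2 / (1 - cabs (lam l) ^+ 2)) <=
  vector_form w.
Proof.
move=> ls.
pose far := [seq k <- s | eta <= pseudo_hyp (lam l) (lam k)].
apply: le_trans (vector_form_blaschke far w).
apply: le_trans (vector_form_local ls _); last first.
  move=> j js jl; suff -> : \prod_(k <- far) blaschke lam (lam k) j = 0 by rewrite mul0r.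
  apply/eqP; rewrite prodf_seq_eq0; apply/hasP; exists j.
    by rewrite mem_filter jl.
  by rewrite /= /blaschke subrr mul0r.
rewrite -mulrA ler_pM2l// (big_rem _ ls)/= -[leLHS]addr0 lerD//; last first.
  by apply: sumr_ge0 => j _; rewrite divr_ge0 ?sqr_ge0// disc_sub_ge0.
rewrite cabsM exprMn -[leRHS]mulrA ler_wpM2r//.
  by rewrite divr_ge0 ?sqr_ge0// disc_sub_ge0.
have cabs_prod (r : seq I) (f : I -> R[i]) :
    cabs (\prod_(k <- r) f k) ^+ 2 = \prod_(k <- r) cabs (f k) ^+ 2.
  elim/big_ind2 : _ => [|x u y v <- <-|//]; first by rewrite cabs1 expr1n.
  by rewrite cabsM exprMn.
rewrite cabs_prod.
apply: le_trans (prod_ge_expR (t := fun k => overlap (lam k) (lam l) / eta ^+ 2) _).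
  rewrite ler_expR lerN2 -mulr_suml ler_wpM2r ?invr_ge0 ?sqr_ge0//.
  apply: le_trans (sum_overlap ls); rewrite big_filter big_mkcond/=.
  by apply: ler_sum => k _; case: ifP => // _; exact: overlap_ge0.
move=> k; rewrite mem_filter => /andP[kl ks].
rewrite cabs_blaschke// expRN_le_sub ?exprn_gt0 ?overlap_ge0//.
by rewrite -pseudo_hyp_sqr// pseudo_hypC ler_sqr ?nnegrE ?pseudo_hyp_ge0// ltW.
Qed.

(** The exponent lost at [lam l] when the bump of [lam k] is split off. *)
Let decay k l := (1 - cabs (lam k) ^+ 2) + 2 * overlap (lam k) (lam l).

Let decay_ge0 k l : 0 <= decay k l.
Proof.
by rewrite addr_ge0 ?disc_sub_ge0// mulr_ge0 ?overlap_ge0.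
Qed.

(** One bump is split off at a time, and the point estimate is applied to it;
    the later points pay the damping factor.  The sum in the exponent runs over
    all of [r] rather than over the earlier points only, which makes the
    induction uniform. *)
Lemma vector_form_damped (r : seq I) z : {subset r <= s} ->
  pairwise (fun k l => cabs (lam l) <= cabs (lam k)) r ->
  D * expR (- (K / eta ^+ 2)) / 4 * (\sum_(l <- r)
    expR (- \sum_(k <- r) decay k l) *
      (cabs (z l) ^+ 2 / (1 - cabs (lam l) ^+ 2))) <= vector_form z.
Proof.
have E0 : 0 <= D * expR (- (K / eta ^+ 2)) by rewrite mulr_ge0 ?expR_ge0// ltW.
elim: r z => [|k r IHr] z rs.
  rewrite big_nil mulr0 => _; apply: sumr_ge0 => i _; exact: szego_form_ge0.
rewrite /= => /andP[/allP kr rr].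
have ks : k \in s by apply: rs; exact: mem_head.
apply: (@le_trans _ _ (vector_form (fun j => damp lam (lam k) j * z j) +
    4^-1 * vector_form (fun j => kernel_bump lam (lam k) j * z j))); last first.
  rewrite /vector_form mulr_sumr -big_split/=; apply: ler_sum => i _.
  apply: le_trans (szego_form_damp_le _ _ _ (lam_disc k)) => //.
  rewrite le_eqVlt; apply/orP; left; apply/eqP; congr (_ + _ * _).
    by apply: eq_szego_form => j _; rewrite mulrCA.
  by apply: eq_szego_form => j _; rewrite mulrCA.
rewrite big_cons mulrDr addrC lerD//; last first.
  apply: le_trans (ler_wpM2l _ (vector_form_point _ ks)); last by rewrite invr_ge0.
  rewrite mulrAC mulrC ler_wpM2l ?invr_ge0// ler_wpM2l//.
  have -> : kernel_bump lam (lam k) k = 1.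
    rewrite /kernel_bump -cabs_sqrE -[1 in X in _ / X](rmorph1 (real_complex R)) -rmorphB.
    by rewrite divff// fmorph_eq0 gt_eqF// disc_sub_gt0.
  rewrite mul1r ler_piMl ?divr_ge0 ?sqr_ge0 ?disc_sub_ge0//.
  by rewrite -[leRHS]expR0 ler_expR oppr_le0 sumr_ge0.
apply: le_trans (IHr _ _ rr); last by move=> j jr; apply: rs; rewrite inE jr orbT.
rewrite ler_wpM2l ?divr_ge0// !big_seq; apply: ler_sum => l lr.
rewrite big_cons opprD expRD cabsM exprMn mulrAC [leLHS]mulrC ler_wpM2l ?expR_ge0//.
rewrite -[leRHS]mulrA ler_wpM2r ?divr_ge0 ?sqr_ge0 ?disc_sub_ge0//.
by apply: damp_lower => //; exact: kr.
Qed.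

(** The points are sorted by decreasing modulus, as the damping estimate
    requires; the three in the exponent collects one bound on the weights and
    two on the overlaps. *)
Theorem vector_form_lower z :
  D * expR (- (K / eta ^+ 2)) / 4 * expR (- (3 * K)) *
    (\sum_(l <- s) cabs (z l) ^+ 2 / (1 - cabs (lam l) ^+ 2)) <= vector_form z.
Proof.
pose e k l := cabs (lam l) <= cabs (lam k).
have ps : perm_eq (sort e s) s by rewrite perm_sort.
have esort : pairwise e (sort e s).
  rewrite -sorted_pairwise; last by move=> x y t /[swap]; exact: le_trans.
  by apply: sort_sorted => x y; exact: le_total.
apply: le_trans (vector_form_damped _ _ esort); last by move=> x; rewrite mem_sort.
rewrite -mulrA ler_wpM2l ?divr_ge0 ?mulr_ge0 ?expR_ge0 ?(ltW D_gt0)//.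
rewrite mulr_sumr (perm_big _ ps)/= !big_seq; apply: ler_sum => l ls.
rewrite ler_wpM2r ?divr_ge0 ?sqr_ge0 ?disc_sub_ge0//.
rewrite ler_expR lerN2 (perm_big _ ps)/= big_split/= -mulr_sumr.
by have := sum_overlap ls; have := sum_weight; lra.
Qed.

End lower_bound.

(** * Sums over families and the inner product of [ell2] *)

Section esum_seq.
Local Open Scope ereal_scope.
Context {R : realType} {I : choiceType}.

Lemma esum_le_seq (f : I -> \bar R) M :
  (forall s : seq I, uniq s -> \sum_(j <- s) f j <= M) ->
  \esum_(j in [set: I]) f j <= M.
Proof.
move=> fM; apply: ge_ereal_sup => _ [X [finX _] <-].
by rewrite fsbig_finite//; exact: fM.
Qed.

Lemma seq_le_esum (f : I -> \bar R) (s : seq I) : uniq s ->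
  \sum_(j <- s) f j <= \esum_(j in [set: I]) f j.
Proof.
move=> us; rewrite fsbig_seq//; apply: esum_ge; exists [set` s]; last by [].
by split; [exact: finite_seq|].
Qed.

(** Any prescribed finite set of indices can be added to an almost exhausting
    one. *)
Lemma esum_tail (f : I -> R) (s0 : seq I) (e : R) :
  (forall j, 0 <= f j)%R -> \esum_(j in [set: I]) (f j)%:E < +oo ->
  (0 < e)%R -> exists s : seq I, [/\ uniq s, {subset s0 <= s} &
    \esum_(j in [set: I]) (if j \in s then 0%R else f j)%:E <= e%:E].
Proof.
move=> f0 foo e0.
have ffin : \esum_(j in [set: I]) (f j)%:E \is a fin_num.
  by rewrite ge0_fin_numE// esum_ge0// => j _; rewrite lee_fin.
have /ereal_sup_gt[_ [X [finX _] <-]] :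
    \esum_(j in [set: I]) (f j)%:E - e%:E < \esum_(j in [set: I]) (f j)%:E.
  by rewrite lteBlDr// lteDl// lte_fin.
have [t tX] := (finite_seqP X).1 finX.
have {tX} -> : X = [set` undup t].
  by rewrite tX; apply/seteqP; split=> j /=; rewrite mem_undup.
rewrite -fsbig_seq ?undup_uniq// => eX.
pose s := undup (undup t ++ s0).
exists s; split; first exact: undup_uniq.
  by move=> j js; rewrite mem_undup mem_cat js orbT.
have split_sum : \esum_(j in [set: I]) (f j)%:E =
    \esum_(j in [set: I]) (if j \in s then 0%R else f j)%:E +
    \esum_(j in [set: I]) (if j \in s then f j else 0%R)%:E.
  rewrite -esumD; last 2 first.
    by move=> j _; rewrite lee_fin; case: ifP.
    by move=> j _; rewrite lee_fin; case: ifP.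
  by apply: eq_esum => j _; case: ifP; rewrite -EFinD ?add0r ?addr0.
have fX : \sum_(i <- undup t) (f i)%:E <=
    \esum_(j in [set: I]) (if j \in s then f j else 0%R)%:E.
  apply: le_trans (seq_le_esum _ (undup_uniq t)).
  rewrite !big_seq; apply: lee_sum => j jX; rewrite lee_fin.
  by rewrite mem_undup mem_cat jX.
have := lt_le_trans eX fX; move: ffin; rewrite split_sum.
set T := \esum_(_ in _) _; set U := \esum_(_ in _) _.
rewrite fin_numD => /andP[/fineK <- /fineK <-].
by rewrite -!EFinD lte_fin lee_fin; lra.
Qed.

End esum_seq.

Section esum_nat.
Local Open Scope ereal_scope.
Context {R : realType}.

Lemma esum_le_series (f : nat -> R) M : (forall n, 0 <= f n)%R ->
  (forall N, \sum_(0 <= n < N) f n <= M)%R ->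
  \esum_(n in [set: nat]) (f n)%:E <= M%:E.
Proof.
move=> f0 fM; rewrite -nneseries_esumT; last by move=> n; rewrite lee_fin.
apply: lime_le; first by apply: is_cvg_nneseries => n _ _; rewrite lee_fin.
by apply: nearW => N; rewrite sumEFin lee_fin fM.
Qed.

Lemma esum_ge_series (f : nat -> R) N :
  (\sum_(0 <= n < N) f n)%:E <= \esum_(n in [set: nat]) (f n)%:E.
Proof.
by rewrite -sumEFin; apply: seq_le_esum; exact: iota_uniq.
Qed.

End esum_nat.

Section inner_product.
Context {R : realType} {I : choiceType}.
Implicit Types (x y : ell2 R I) (s : seq I).

Lemma sqsum_fin x : sqsum x \is a fin_num.
Proof.
rewrite ge0_fin_numE; first by have := valP x; rewrite inE.
by apply: esum_ge0 => j _; rewrite lee_fin sqr_ge0.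
Qed.

Lemma l2norm_sqrE x : (l2norm x ^+ 2)%:E = sqsum x.
Proof.
rewrite /l2norm sqr_sqrtr ?fineK ?sqsum_fin// fine_ge0//.
by apply: esum_ge0 => j _; rewrite lee_fin sqr_ge0.
Qed.

Lemma sum_le_l2norm x s : uniq s ->
  \sum_(j <- s) cabs (x j) ^+ 2 <= l2norm x ^+ 2.
Proof.
by move=> us; rewrite -lee_fin l2norm_sqrE -sumEFin; exact: seq_le_esum.
Qed.

Lemma ell2D x y j : (x + y) j = x j + y j. Proof. by []. Qed.

Lemma ell2B x y j : (x - y) j = x j - y j. Proof. by []. Qed.

Lemma ell2Z (c : R[i]) x j : (c *: x) j = c * x j. Proof. by []. Qed.

Lemma ell2_sum (T : Type) (r : seq T) (F : T -> ell2 R I) j :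
  (\sum_(k <- r) F k) j = \sum_(k <- r) F k j.
Proof. by elim/big_rec2 : _ => // k u v _ <-. Qed.

Definition finite_vector s (z : I -> R[i]) : ell2 R I :=
  \sum_(j <- s) z j *: ell2_basis j.

Lemma finite_vectorE s z j : uniq s ->
  finite_vector s z j = if j \in s then z j else 0.
Proof.
move=> us; rewrite /finite_vector ell2_sum.
under eq_bigr do rewrite ell2Z /=.
case: ifPn => js.
  rewrite (big_rem _ js)/= eqxx mulr1 big_seq big1 ?addr0// => k.
  by rewrite mem_rem_uniq// inE => /andP[/negbTE kj _]; rewrite eq_sym kj mulr0.
rewrite big_seq big1// => k ks; case: eqP => [jk|]; last by rewrite mulr0.
by rewrite jk ks in js.
Qed.

Lemma l2norm_finite_vector s z : uniq s ->
  l2norm (finite_vector s z) ^+ 2 = \sum_(j <- s) cabs (z j) ^+ 2.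
Proof.
move=> us; apply: EFin_inj; rewrite l2norm_sqrE /sqsum -sumEFin.
rewrite fsbig_seq// -esum_fset; last by move=> *; rewrite lee_fin sqr_ge0.
  rewrite [RHS]esum_mkcond; apply: eq_esum => j _.
  rewrite finite_vectorE// mem_setE; case: ifP => // _.
  by rewrite cabs0 expr0n.
exact: finite_seq.
Qed.

(** Density of the finitely supported vectors; [s0] prescribes indices that the
    truncation has to keep. *)
Lemma l2norm_approx x s0 (e : R) : 0 < e -> exists s,
  [/\ uniq s, {subset s0 <= s} & l2norm (x - finite_vector s x) ^+ 2 <= e].
Proof.
move=> e0; have xoo : (\esum_(j in [set: I]) (cabs (x j) ^+ 2)%:E < +oo)%E.
  by rewrite -/(sqsum x) -l2norm_sqrE ltry.
have [s [us s0s se]] := @esum_tail R I _ s0 e (fun j => sqr_ge0 (cabs (x j))) xoo e0.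
exists s; split => //; rewrite -lee_fin l2norm_sqrE; apply: le_trans se.
apply: le_esum => j _; rewrite ell2B finite_vectorE// lee_fin.
by case: ifP; rewrite ?subrr ?subr0// cabs0 expr0n.
Qed.

Lemma esum_mul_le x y (t : R) : 0 < t ->
  (\esum_(j in [set: I]) (cabs (x j * conjc (y j)))%:E <=
   ((t * l2norm x ^+ 2 + t^-1 * l2norm y ^+ 2) / 2)%:E)%E.
Proof.
move=> t0; apply: esum_le_seq => s us; rewrite sumEFin lee_fin.
apply: (@le_trans _ _ (\sum_(j <- s)
    (t * cabs (x j) ^+ 2 + t^-1 * cabs (y j) ^+ 2) / 2)).
  by apply: ler_sum => j _; rewrite cabsM cabs_conj young_ineq.
rewrite -mulr_suml ler_wpM2r ?invr_ge0// big_split/= -!mulr_sumr.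
by rewrite lerD// ler_wpM2l ?sum_le_l2norm ?invr_ge0// ltW.
Qed.

Lemma rsum_abs (f g : I -> R) (M : R) : (forall j, `|f j| <= g j) ->
  (\esum_(j in [set: I]) (g j)%:E <= M%:E)%E -> `|rsum f| <= M.
Proof.
move=> fg gM.
have pM : (esum setT (EFin \o f)^\+ <= M%:E)%E.
  apply: le_trans gM; apply: le_esum => j _; rewrite funeposE/= -EFin_max lee_fin.
  by have := fg j; rewrite ler_norml ge_max => /andP[? ->]/=; apply: le_trans (fg j).
have nM : (esum setT (EFin \o f)^\- <= M%:E)%E.
  apply: le_trans gM; apply: le_esum => j _.
  rewrite funenegE/= -?EFinN -EFin_max lee_fin.
  have := fg j; rewrite ler_norml ge_max lerNl => /andP[-> _]/=.
  exact: le_trans (fg j).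
have p0 : (0 <= esum setT (EFin \o f)^\+)%E by apply: esum_ge0.
have n0 : (0 <= esum setT (EFin \o f)^\-)%E by apply: esum_ge0.
rewrite /rsum; move: pM nM p0 n0; set P := esum _ _; set N := esum _ _.
case: P => [p| |]//; case: N => [n| |]//.
by rewrite !lee_fin /= ler_norml => *; apply/andP; split; lra.
Qed.

Lemma rsumD (f g : I -> R) :
  summable setT (EFin \o f) -> summable setT (EFin \o g) ->
  rsum (fun j => f j + g j) = rsum f + rsum g.
Proof.
move=> sf sg.
have fin (h : I -> \bar R) : (forall j, 0 <= h j)%E -> summable setT h ->
    esum setT h \is a fin_num.
  move=> h0; rewrite summableE; congr (_ \is a fin_num).
  by apply: eq_esum => j _; rewrite gee0_abs.
have [sfp sfn] := (summable_funepos sf, summable_funeneg sf).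
have [sgp sgn] := (summable_funepos sg, summable_funeneg sg).
(* The sum is a difference of nonnegative summable families in two ways. *)
have fE : EFin \o (fun j => f j + g j) =
    (((EFin \o f)^\+ \+ (EFin \o g)^\+) \- ((EFin \o f)^\- \+ (EFin \o g)^\-))%E.
  apply/funext => j /=; rewrite !funeposE !funenegE /= -?EFinN -!EFin_max.
  rewrite -!EFinD; congr EFin; rewrite !maxEle.
  by do ![case: ifPn; rewrite -?ltNge => ?]; lra.
rewrite /rsum fE esumB; last 4 first.
- exact: summableD.
- exact: summableD.
- by move=> j _; rewrite adde_ge0.
- by move=> j _; rewrite adde_ge0.
rewrite !esumD// -fineD; last 2 first.
- by rewrite fin_numB !fin.
- by rewrite fin_numB !fin.
congr fine.
have := fin _ (funepos_ge0 _) sfp; have := fin _ (funeneg_ge0 _) sfn.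
have := fin _ (funepos_ge0 _) sgp; have := fin _ (funeneg_ge0 _) sgn.
move=> /fineK <- /fineK <- /fineK <- /fineK <-.
by rewrite -?EFinN -!EFinD; congr EFin; lra.
Qed.

Lemma rsum1 (f : I -> R) k : (forall j, j != k -> f j = 0) -> rsum f = f k.
Proof.
move=> f0.
have single (h : I -> \bar R) : (forall j, 0 <= h j)%E ->
    (forall j, j != k -> h j = 0%E) -> esum setT h = h k.
  move=> h0 hk; rewrite -(esum_set1 (h0 k)) [RHS]esum_mkcond.
  apply: eq_esum => j _; case: ifPn => //.
  by rewrite notin_setE => /eqP/hk.
rewrite /rsum !single//.
- rewrite funeposE funenegE /= -?EFinN -!EFin_max -EFinB /= !maxEle.
  by do ![case: ifPn; rewrite -?ltNge => ?]; lra.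
- by move=> j jk; rewrite funenegE /= f0// ?oppe0 ?oppr0 maxxx.
- by move=> j jk; rewrite funeposE /= f0// maxxx.
Qed.

Let summable_dot (p : R[i] -> R) x y : (forall u, `|p u| <= cabs u) ->
  summable setT (EFin \o (fun j => p (x j * conjc (y j)))).
Proof.
move=> pu; rewrite /summable.
apply: le_lt_trans (le_lt_trans (esum_mul_le x y (@ltr01 R)) (ltry _)).
by apply: le_esum => j _; rewrite /= lee_fin.
Qed.

Lemma dot2D x x' y : dot2 (x + x') y = dot2 x y + dot2 x' y.
Proof.
rewrite /dot2 /csum -[RHS]/(Complex _ _) -!rsumD.
- congr Complex; congr rsum; apply/funext => j; rewrite ell2D mulrDl;
    by case: (x j * _) (x' j * _) => a b [c d].
- exact: summable_dot le_Im_cabs.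
- exact: summable_dot le_Im_cabs.
- exact: summable_dot le_Re_cabs.
- exact: summable_dot le_Re_cabs.
Qed.

Lemma dot2_basis (c : R[i]) j y : dot2 (c *: ell2_basis j) y = c * conjc (y j).
Proof.
have z k : k != j -> (c *: ell2_basis j) k * conjc (y k) = 0.
  by move=> /negbTE kj; rewrite ell2Z /= kj mulr0 mul0r.
rewrite /dot2 /csum (@rsum1 _ j) ?(@rsum1 _ j); last 2 first.
- by move=> k /z ->.
- by move=> k /z ->.
by rewrite ell2Z /= eqxx mulr1; case: (c * _).
Qed.

(** Continuity of [dot2] in its first argument.  Stating it with an arbitrary
    bound [t] on the squared norm, not the norm itself, keeps the optimal
    parameter [1 / sqrt t] in the Young inequality positive. *)
Lemma dot2_bounded y : exists2 M : R, 0 <= M &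
  forall x (t : R), 0 < t -> l2norm x ^+ 2 <= t ->
    cabs (dot2 x y) ^+ 2 <= M * t.
Proof.
pose Y := l2norm y ^+ 2; have Y0 : 0 <= Y by exact: sqr_ge0.
exists ((1 + Y) ^+ 2 / 2) => [|x t t0 xt]; first by rewrite divr_ge0 ?sqr_ge0.
have r0 : 0 < Num.sqrt t by rewrite sqrtr_gt0.
have rt : Num.sqrt t ^+ 2 = t by rewrite sqr_sqrtr// ltW.
move: (Num.sqrt t) r0 rt => r r0 rt.
have iv : 0 < r^-1 by rewrite invr_gt0.
have b : (\esum_(j in [set: I]) (cabs (x j * conjc (y j)))%:E <=
    (r * (1 + Y) / 2)%:E)%E.
  apply: le_trans (esum_mul_le x y iv) _; rewrite lee_fin ler_wpM2r ?invr_ge0//.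
  rewrite invrK mulrDr mulr1 lerD2r -/Y ler_pdivrMl// -expr2 rt//.
rewrite cabs_sqr /dot2 /csum /=.
have q0 : 0 <= r * (1 + Y) / 2 by rewrite divr_ge0// mulr_ge0 ?addr_ge0// ltW.
have := rsum_abs (fun j => le_Re_cabs (x j * conjc (y j))) b.
have := rsum_abs (fun j => le_Im_cabs (x j * conjc (y j))) b.
move: (rsum _) (rsum _) => v u.
have sq (w : R) : `|w| <= r * (1 + Y) / 2 -> w ^+ 2 <= (r * (1 + Y) / 2) ^+ 2.
  by move=> wq; rewrite -[w ^+ 2]real_normK ?num_real// ler_sqr ?nnegrE.
move=> /sq vb /sq ub.
have -> : (1 + Y) ^+ 2 / 2 * t =
    (r * (1 + Y) / 2) ^+ 2 + (r * (1 + Y) / 2) ^+ 2 by rewrite -rt; field.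
exact: lerD.
Qed.

Lemma dot2_finite_vector s z y :
  dot2 (finite_vector s z) y = \sum_(j <- s) z j * conjc (y j).
Proof.
rewrite /finite_vector; elim: s => [|j s IHs].
  by rewrite !big_nil; apply: (addrI (dot2 0 y)); rewrite -dot2D !addr0.
by rewrite !big_cons dot2D dot2_basis IHs.
Qed.

End inner_product.

(** * Integrals against atomic measures and Carleson embeddings *)

Import HBNNSimple.

Lemma ge0_esumZl (R : realType) (I : choiceType) (c : R) (f : I -> \bar R) :
  0 <= c -> (forall j, 0 <= f j)%E ->
  (\esum_(j in [set: I]) (c%:E * f j) = c%:E * \esum_(j in [set: I]) f j)%E.
Proof.
have le (b : R) (g : I -> \bar R) : 0 <= b -> (forall j, 0 <= g j)%E ->
    (\esum_(j in [set: I]) (b%:E * g j) <= b%:E * \esum_(j in [set: I]) g j)%E.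
  move=> b0 g0; apply: esum_le_seq => s us.
  by rewrite -ge0_sume_distrr// lee_wpmul2l ?lee_fin// seq_le_esum.
rewrite le_eqVlt => /predU1P[<- f0|c0 f0].
  by rewrite mul0e esum1// => j _; rewrite mul0e.
apply/le_anti; rewrite le ?(ltW c0)//=.
have cV (y : \bar R) : (c^-1%:E * (c%:E * y) = y)%E.
  by rewrite muleA -EFinM mulVf ?gt_eqF// mul1e.
have := le c^-1 (fun j => c%:E * f j)%E.
under [X in (X <= _)%E]eq_esum do rewrite cV.
rewrite invr_ge0 ltW// => /(_ isT) h.
rewrite -[leRHS]mul1e -(@mulfV _ c) ?gt_eqF// EFinM -muleA.
rewrite lee_wpmul2l ?lee_fin ?(ltW c0)// h// => j.
by rewrite mule_ge0// lee_fin ltW.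
Qed.

Section atomic_integral.
Local Open Scope ereal_scope.
Context {R : realType} {I : choiceType} d (T : measurableType d).
Variables (w : I -> {nonneg R}) (x : I -> T).

Lemma sintegral_atomic (h : {nnsfun T >-> R}) :
  sintegral (atomic w x) h = \esum_(j in [set: I]) ((w j)%:num * h (x j))%:E.
Proof.
have [L hL] := (finite_seqP _).1 (fimfunP h).
have uL : range h = [set` undup L].
  by rewrite hL; apply/seteqP; split=> r /=; rewrite mem_undup.
rewrite sintegralE uL -fsbig_seq ?undup_uniq//.
transitivity (\sum_(r <- undup L) \esum_(j in [set: I])
    (r%:E * ((w j)%:num%:E * \d_(x j) (h @^-1` [set r])))).
  apply: eq_big_seq => r rL; rewrite ge0_esumZl//.
    have : range h r by rewrite uL.
    by move=> [t _ <-].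
  by move=> j; rewrite mule_ge0.
rewrite big_seq -esum_sum//; last first.
  move=> j r _ rL; have [t _ <-] : range h r by rewrite uL.
  by apply: mule_ge0; [rewrite lee_fin|exact: mule_ge0].
apply: eq_esum => j _.
have xL : h (x j) \in undup L.
  have : range h (h (x j)) by exists (x j).
  by rewrite uL.
rewrite -big_seq (big_rem _ xL)/= diracE mem_set// mule1 -EFinM mulrC big_seq big1 ?adde0// => r.
rewrite mem_rem_uniq ?undup_uniq// inE => /andP[rh _].
rewrite diracE memNset ?mule0// => /= hr.
by rewrite hr eqxx in rh.
Qed.

(** The integral is the supremum of the integrals of the simple functions below
    [g], so that the bound for arbitrary [g] follows from the one for simple
    functions.  This matters since Hardy functions have arbitrary values off
    the disc. *)
Lemma atomic_integral_le (D : set T) (g : T -> R) M :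
  (forall z, 0 <= g z)%R ->
  (forall s : seq I, uniq s -> (\sum_(j <- s) (w j)%:num * g (x j) <= M)%R) ->
  \int[atomic w x]_(z in D) (g z)%:E <= M%:E.
Proof.
move=> g0 gM; rewrite ge0_integralE; last by move=> z _; rewrite lee_fin.
apply: ge_ereal_sup => _ [h hg <-]; rewrite sintegral_atomic.
apply: esum_le_seq => s us; rewrite sumEFin lee_fin.
apply: le_trans (gM s us); apply: ler_sum => j _; rewrite ler_wpM2l//.
have := hg (x j); rewrite patchE; case: ifP; rewrite lee_fin// => _ hx.
exact: le_trans hx _.
Qed.

(** The simple function that agrees with [g] on the finitely many points
    [x j], [j] in [s], and vanishes elsewhere is below [g]. *)
Lemma atomic_integral_ge (D : set T) (g : T -> R) (s : seq I) :
  (forall z, 0 <= g z)%R -> (forall z, measurable [set z : T]) -> uniq s ->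
  (forall j, D (x j)) ->
  (\sum_(j <- s) (w j)%:num * g (x j))%:E <=
    \int[atomic w x]_(z in D) (g z)%:E.
Proof.
move=> g0 mT us xD; rewrite ge0_integralE; last by move=> z _; rewrite lee_fin.
have [h hE] : exists h : {nnsfun T >-> R},
    h =1 (fun z => \sum_(y <- undup [seq x j | j <- s]) g y * \1_[set y] z)%R.
  elim: (undup _) => [|y L [h hE]].
    exists nnsfun0 => z; rewrite big_nil//.
  exists (add_nnsfun (scale_nnsfun (indic_nnsfun R (mT y)) (g0 y)) h) => z.
  by rewrite big_cons /= hE.
have hx z : h z = if z \in [seq x j | j <- s] then g z else 0%R.
  rewrite hE; case: ifPn => zs.
    have zu : z \in undup [seq x j | j <- s] by rewrite mem_undup.
    rewrite (big_rem _ zu)/= indicE mem_set// mulr1 big_seq big1 ?addr0// => y.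
    rewrite mem_rem_uniq ?undup_uniq// inE => /andP[yz _].
    by rewrite indicE memNset ?mulr0// => /= zy; rewrite zy eqxx in yz.
  rewrite big_seq big1// => y; rewrite mem_undup => ys.
  by rewrite indicE memNset ?mulr0// => /= zy; rewrite zy ys in zs.
apply: (@le_trans _ _ (sintegral (atomic w x) h)).
  rewrite sintegral_atomic; apply: le_trans (seq_le_esum _ us).
  rewrite sumEFin lee_fin !big_seq; apply: ler_sum => j js.
  by rewrite hx map_f.
apply: ereal_sup_ubound; exists h => // z.
rewrite patchE hx; case: ifPn => [zs|_]; last by case: ifP; rewrite lee_fin.
by rewrite mem_set//; move/mapP : zs => [j _ ->].
Qed.

End atomic_integral.

Section carleson_sums.
Context {R : realType} {I : choiceType} (lam : I -> R[i]).
Hypothesis lam_disc : forall j, disc R (lam j).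

Lemma disc_weightE j : (disc_weight (lam j))%:num = 1 - cabs (lam j) ^+ 2.
Proof. by rewrite /= max_r// disc_sub_ge0. Qed.

Lemma measurable_point (z : borelC R) : measurable [set z].
Proof.
rewrite -[X in measurable X]setCK; apply: measurableC.
apply: sub_sigma_algebra; apply: closed_openC.
apply: accessible_closed_set1; apply: hausdorff_accessible.
exact: norm_hausdorff.
Qed.

Lemma carleson_of_sums (C : R) :
  (forall (c : ell2 R nat) (f : R[i] -> R[i]), hardy2 c f ->
    forall s : seq I, uniq s ->
    \sum_(j <- s) (1 - cabs (lam j) ^+ 2) * cabs (f (lam j)) ^+ 2 <=
    C * l2norm c ^+ 2) ->
  carleson (eigen_measure lam).
Proof.
move=> hC; exists C => c f hf.
apply: (@atomic_integral_le _ _ _ _ _ (lam : I -> borelC R) _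
  (fun z => cabs (f z) ^+ 2)) => [z|s us]; first exact: sqr_ge0.
by apply: le_trans (hC c f hf s us); apply: ler_sum => j _; rewrite disc_weightE.
Qed.

Lemma hardy2_polynomial N (g : nat -> R[i]) :
  hardy2 (finite_vector (iota 0 N) g)
    (fun z => \sum_(0 <= n < N) g n * z ^+ n).
Proof.
move=> z _; apply: cvg_near_cst; exists N => //= k /= Nk.
rewrite /series /= (big_cat_nat _ (n := N))//= [X in _ + X]big1_seq ?addr0.
  apply: eq_big_nat => n /andP[_ nN].
  by rewrite finite_vectorE ?iota_uniq// mem_iota/= add0n nN.
move=> n /andP[_]; rewrite mem_index_iota => /andP[Nn _].
by rewrite finite_vectorE ?iota_uniq// mem_iota/= add0n ltnNge Nn/= mul0r.
Qed.

(** On polynomials the Carleson condition is an inequality between finite sums;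
    truncated kernels and Taylor polynomials are the only functions on which it
    gets tested. *)
Lemma carleson_polynomial : carleson (eigen_measure lam) ->
  exists2 C : R, 0 < C & forall N (g : nat -> R[i]) (s : seq I), uniq s ->
    \sum_(j <- s) (1 - cabs (lam j) ^+ 2) *
      cabs (\sum_(0 <= n < N) g n * lam j ^+ n) ^+ 2 <=
    C * \sum_(0 <= n < N) cabs (g n) ^+ 2.
Proof.
move=> [C hC]; exists (`|C| + 1); first by rewrite ltr_wpDl.
move=> N g s us.
have := hC _ _ (@hardy2_polynomial N g).
rewrite l2norm_finite_vector ?iota_uniq//.
move=> /(le_trans (@atomic_integral_ge _ _ _ _ (fun j => disc_weight (lam j))
  (lam : I -> borelC R) _ (fun z => cabs (\sum_(0 <= n < N) g n * z ^+ n) ^+ 2) _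
  (fun z => sqr_ge0 _) measurable_point us lam_disc)).
rewrite lee_fin; under eq_bigr do rewrite disc_weightE.
move=> /le_trans -> //; rewrite /index_iota subn0 ler_wpM2r//.
  by apply: sumr_ge0 => n _; exact: sqr_ge0.
by rewrite (le_trans (ler_norm _))// lerDl.
Qed.

(** Testing the Carleson condition on truncations of the Szegő kernel at [a];
    the truncation order is chosen so that the tail costs a factor at most
    two in modulus. *)
Lemma carleson_overlap (C : R) (s : seq I) (a : R[i]) : 0 < C -> disc R a ->
  (forall N (g : nat -> R[i]),
    \sum_(j <- s) (1 - cabs (lam j) ^+ 2) *
      cabs (\sum_(0 <= n < N) g n * lam j ^+ n) ^+ 2 <=
    C * \sum_(0 <= n < N) cabs (g n) ^+ 2) ->
  \sum_(j <- s) overlap (lam j) a <= 4 * C.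
Proof.
move=> C0 a1 hC; have A0 := disc_sub_gt0 a1.
have [N hN] : exists N, cabs a ^+ N <= 2^-1.
  have h : (fun N => cabs a ^+ N) @ \oo --> (0 : R).
    by apply: cvg_expr; rewrite ger0_norm ?cabs_ge0.
  have [N _ hN] : \forall N \near \oo, cabs a ^+ N < 2^-1.
    by apply: (cvgr_lt _ h); rewrite invr_gt0.
  by exists N; apply/ltW/hN => /=.
have := hC N (fun n => conjc a ^+ n).
have geo (u : R[i]) : (\sum_(0 <= n < N) u ^+ n) * (1 - u) = 1 - u ^+ N.
  by rewrite big_mkord -opprB mulrN -[u - 1]/(u - 1) mulrC -subrX1 opprB.
have gsum : \sum_(0 <= n < N) cabs (conjc a ^+ n) ^+ 2 <= (1 - cabs a ^+ 2)^-1.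
  rewrite -[leRHS]mul1r ler_pdivlMr// (_ : \sum_(0 <= n < N) _ =
      \sum_(0 <= n < N) (cabs a ^+ 2) ^+ n); last first.
    by apply: eq_bigr => n _; rewrite cabsX cabs_conj exprAC.
  rewrite big_mkord mulrC -opprB mulNr -subrX1 opprB gerBl.
  by rewrite exprn_ge0 ?sqr_ge0.
move=> h.
have {h} : \sum_(j <- s) (1 - cabs (lam j) ^+ 2) *
      cabs (\sum_(0 <= n < N) conjc a ^+ n * lam j ^+ n) ^+ 2 <=
    C * (1 - cabs a ^+ 2)^-1.
  by apply: le_trans h _; rewrite ler_pM2l.
rewrite -(ler_pM2l A0) mulrCA divff ?gt_eqF// mulr1 mulr_sumr => h.
rewrite -ler_pdivrMl// mulr_sumr; apply: le_trans h; apply: ler_sum => j _.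
set u := conjc a * lam j.
have u1 : cabs u < 1 by exact: cabs_conjM_lt1.
have -> : \sum_(0 <= n < N) conjc a ^+ n * lam j ^+ n = (1 - u ^+ N) / (1 - u).
  rewrite -geo mulfK ?sub1_neq0//; apply: eq_bigr => n _.
  by rewrite exprMn.
have uN : 2^-1 <= cabs (1 - u ^+ N).
  have : 1 <= cabs (1 - u ^+ N) + cabs (u ^+ N).
    by rewrite -[leLHS](@cabs1 R) (le_trans _ (le_cabsD _ _))// subrK.
  have : cabs (u ^+ N) <= 2^-1.
    apply: le_trans hN; rewrite cabsX lerXn2r ?nnegrE ?cabs_ge0//.
    by rewrite cabsM cabs_conj ler_piMr ?cabs_ge0// ltW// lam_disc.
  lra.
have -> : overlap (lam j) a =
    (1 - cabs a ^+ 2) * ((1 - cabs (lam j) ^+ 2) / cabs (1 - u) ^+ 2).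
  rewrite /overlap -[X in _ / X ^+ 2]cabs_conj conjcB conjcM conjc1 conjcK.
  by rewrite [lam j * _]mulrC -/u; ring.
rewrite mulrCA ler_pM2l// mulrCA ler_wpM2l ?disc_sub_ge0//.
rewrite cabsM cabsV exprMn exprVn ler_wpM2r ?invr_ge0 ?sqr_ge0//.
rewrite (_ : 4^-1 = 2^-1 ^+ 2); last by field.
by rewrite ler_sqr ?nnegrE ?cabs_ge0 ?invr_ge0.
Qed.

End carleson_sums.

(** * Finite sets as duplicate-free sequences *)

Section finite_sets.
Context {I : choiceType}.

Lemma seq_card_eq (t : seq I) : uniq t -> ([set` t] #= `I_(size t))%card.
Proof.
move=> ut; rewrite (_ : [set` t] = [set` [fset x in t]%fset]); last first.
  by apply/seteqP; split => x /=; rewrite inE.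
by apply/card_eq_fsetP; rewrite card_fseq undup_id.
Qed.

Lemma card_le_seqP (A : set I) m :
  (A #<= `I_m)%card <-> exists t : seq I, [/\ uniq t, (size t <= m)%N & A = [set` t]].
Proof.
split=> [Am|[t [ut tm ->]]]; last first.
  by rewrite (card_le_eql (seq_card_eq ut)) card_le_II.
have [t At] := (finite_seqP A).1 (card_le_finite Am (finite_II m)).
have {}At : A = [set` undup t].
  by rewrite At; apply/seteqP; split=> j /=; rewrite mem_undup.
exists (undup t); split=> //; first exact: undup_uniq.
by rewrite At (card_le_eql (seq_card_eq (undup_uniq t))) card_le_II in Am.
Qed.

Lemma card_le_of_uniq (A : set I) m :
  (forall t : seq I, uniq t -> (forall j, j \in t -> A j) -> (size t <= m)%N) ->
  (A #<= `I_m)%card.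
Proof.
move=> hA; have [finA|infA] := pselect (finite_set A).
  have [t At] := (finite_seqP A).1 finA.
  apply/card_le_seqP; exists (undup t); split; first exact: undup_uniq.
    by apply: hA; [exact: undup_uniq|move=> j; rewrite mem_undup At].
  by rewrite At; apply/seteqP; split=> j /=; rewrite mem_undup.
have [B BA Bm] := infinite_set_fset m.+1 infA.
have := hA B (fset_uniq B) BA.
by rewrite leqNgt Bm.
Qed.

End finite_sets.

(** * From a Riesz sequence to local independence *)

Section riesz.
Context {R : realType} {I : choiceType} (lam : I -> R[i]).
Context (m : nat) (alpha : 'I_m -> I -> R[i]).

(** The squared norm of the coefficients with respect to the normalised
    kernels. *)
Definition diag_form (s : seq I) (y : I -> R[i]) : R :=
  \sum_(j <- s) cabs (y j) ^+ 2 / (1 - cabs (lam j) ^+ 2).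

(** In terms of normalised kernels: the vectors [alpha_j (x) K_j] form a Riesz
    sequence in the vector-valued Hardy space. *)
Definition riesz : Prop := exists c0 c1 : R, [/\ 0 < c0, 0 < c1 &
  forall (s : seq I) (y : I -> R[i]), uniq s ->
    c0 * diag_form s y <= vector_form lam alpha s y <= c1 * diag_form s y].

Definition local_condition (eta D0 : R) : Prop :=
  [/\ 0 < eta < 1,
      0 < D0,
      forall j, (lam @^-1` pseudo_ball (lam j) eta #<= `I_m)%card &
      forall (j1 : I) (p : nat) (js : p.-tuple I), (p <= m)%N -> uniq js ->
        [set` js] = lam @^-1` pseudo_ball (lam j1) eta ->
        forall c : 'I_p -> R[i],
          D0 ^+ 2 * \sum_(s < p) cabs (c s) ^+ 2 <=
          \sum_(i < m) cabs (\sum_(s < p) alpha i (tnth js s) * c s) ^+ 2].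

Hypothesis lam_disc : forall j, disc R (lam j).
Hypothesis alpha_unit : forall j, \sum_(i < m) cabs (alpha i j) ^+ 2 = 1.

Lemma diag_form_ge0 s y : 0 <= diag_form s y.
Proof. by apply: sumr_ge0 => j _; rewrite divr_ge0 ?sqr_ge0 ?disc_sub_ge0. Qed.

Let cvg_cabs (u : nat -> R[i]) (l : R[i]) :
  (u : nat -> R[i]^o) @ \oo --> (l : R[i]^o) ->
  (fun n => cabs (l - u n)) @ \oo --> (0 : R).
Proof.
move=> /cvgrPdist_lt ul; apply/cvgrPdist_lt => e e0.
have := ul e%:C; rewrite ltcR => /(_ e0); apply: filterS => n /=.
rewrite normc_def -[X in X%:C]/(Num.sqrt _) ltcR => h.
rewrite sub0r normrN ger0_norm ?cabs_ge0//; apply: le_lt_trans h.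
by case: (l - u n).
Qed.

(** Duality: the Bessel bound for the kernels is the Carleson embedding for
    their adjoint, coordinate by coordinate. *)
Lemma carleson_of_riesz : riesz -> carleson (eigen_measure lam).
Proof.
move=> [c0 [c1 [_ c1_gt0 hr]]]; apply: (carleson_of_sums lam_disc (C := m%:R * c1)).
move=> c f hf s us.
pose wt j := 1 - cabs (lam j) ^+ 2.
have wt0 j : 0 <= wt j by exact: disc_sub_ge0.
pose L i := \sum_(j <- s) wt j * cabs (alpha i j) ^+ 2 * cabs (f (lam j)) ^+ 2.
have -> : \sum_(j <- s) wt j * cabs (f (lam j)) ^+ 2 = \sum_(i < m) L i.
  rewrite exchange_big; apply: eq_bigr => j _ /=.
  by rewrite -mulr_suml -mulr_sumr alpha_unit mulr1.
suff Lle i : L i <= c1 * l2norm c ^+ 2.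
  apply: (@le_trans _ _ (\sum_(i < m) c1 * l2norm c ^+ 2)).
    by apply: ler_sum => i _; exact: Lle.
  by rewrite sumr_const card_ord -mulrA mulr_natl.
(* The coefficients for which the pairing of the combination with [f] is
   [L i], while its diagonal form is also [L i]. *)
pose y j := (wt j)%:C * conjc (alpha i j) * f (lam j).
pose G n := \sum_(j <- s) alpha i j * y j * conjc (lam j) ^+ n.
have Gle N : \sum_(0 <= n < N) cabs (G n) ^+ 2 <= c1 * L i.
  have /andP[_] := hr s y us.
  have -> : diag_form s y = L i.
    apply: eq_bigr => j _; rewrite /y !cabsM cabs_conj cabs_real.
    rewrite ger0_norm ?disc_sub_ge0// -/(wt j).
    by have : wt j != 0; [rewrite gt_eqF// disc_sub_gt0|move=> h; field].
  apply: le_trans.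
  rewrite /vector_form (bigD1 i)//= -[leLHS]addr0 lerD//; last first.
    by apply: sumr_ge0 => k _; exact: szego_form_ge0.
  have : \sum_(0 <= n < N) cabs (G n) ^+ 2 = _ :=
    szego_form_telescope lam_disc s (fun j => alpha i j * y j) N.
  move=> ->.
  by rewrite gerBl szego_form_ge0.
(* The pairing only sees the partial sums of [f]; [E N] is the error. *)
pose fN N z := \sum_(0 <= n < N) c n * z ^+ n.
pose E N := \sum_(j <- s) wt j * cabs (alpha i j) ^+ 2 * cabs (f (lam j)) *
  cabs (f (lam j) - fN N (lam j)).
have cE : E @ \oo --> (0 : R).
  rewrite [X in _ --> X](_ : 0 = \sum_(j <- s)
      wt j * cabs (alpha i j) ^+ 2 * cabs (f (lam j)) * 0); last first.
    by rewrite big1// => j _; rewrite mulr0.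
  apply: cvg_finite_sum => j; apply: cvgMr; apply: cvg_cabs.
  exact: (hf (lam j) (lam_disc j)).
have key N : L i <= (c1 * l2norm c ^+ 2 + L i) / 2 + E N.
  have LC : (L i)%:C = \sum_(0 <= n < N) conjc (c n) * G n +
      \sum_(j <- s) (wt j * cabs (alpha i j) ^+ 2)%:C * f (lam j) *
        conjc (f (lam j) - fN N (lam j)).
    have -> : \sum_(0 <= n < N) conjc (c n) * G n =
        \sum_(j <- s) (wt j * cabs (alpha i j) ^+ 2)%:C * f (lam j) *
          conjc (fN N (lam j)).
      under eq_bigr do rewrite mulr_sumr.
      rewrite exchange_big; apply: eq_bigr => j _ /=.
      rewrite conjc_sum mulr_sumr; apply: eq_bigr => n _.
      rewrite conjcM conjcX rmorphM/= cabs_sqrE /y.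
      by ring.
    rewrite -big_split/= /L (rmorph_sum (real_complex R)).
    apply: eq_bigr => j _; rewrite /= conjcB -mulrDr addrC subrK.
    by rewrite rmorphM/= cabs_sqrE mulrA.
  have L0 : 0 <= L i.
    by apply: sumr_ge0 => j _; rewrite !mulr_ge0 ?cabs_ge0.
  rewrite -[leLHS](ger0_norm L0) -cabs_real LC (le_trans (le_cabsD _ _))// lerD//.
    apply: le_trans (young_sum _ _ _ c1_gt0) _.
    rewrite ler_wpM2r ?invr_ge0// lerD//.
      rewrite ler_pM2l//; under eq_bigr do rewrite cabs_conj.
      by rewrite sum_le_l2norm// iota_uniq.
    by rewrite ler_pdivrMl.
  apply: le_trans (cabs_sum _ _) _; apply: ler_sum => j _.
  by rewrite !cabsM cabs_conj cabs_real ger0_norm// mulr_ge0 ?sqr_ge0.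
have : L i <= (c1 * l2norm c ^+ 2 + L i) / 2 + 0.
  by apply: (ler_cvg_to (cvg_cst (L i)) (cvgD (cvg_cst _) cE)); exact: nearW.
by lra.
Qed.

(** Multiplying by the Blaschke factor at [lam l] makes the form small near
    [lam l], so the rank-one remainder, in which only the vectors [alpha j]
    enter, inherits the lower bound. *)
Lemma local_lower_bound_of_riesz (c0 : R) (eta : R) (l : I) (t : seq I) (c : I -> R[i]) :
  0 < c0 -> 0 <= eta -> 2 ^+ m.+1 * eta ^+ 2 <= c0 / 2 ->
  (size t <= m.+1)%N ->
  (forall y, c0 * diag_form t y <= vector_form lam alpha t y) ->
  (forall j, j \in t -> pseudo_hyp (lam l) (lam j) <= eta) ->
  c0 / 2 * \sum_(j <- t) cabs (c j) ^+ 2 <=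
  \sum_(i < m) cabs (\sum_(j <- t) alpha i j * c j) ^+ 2.
Proof.
move=> c00 eta0 etac tm lower near.
have l1 := lam_disc l; have A0 := disc_sub_gt0 l1.
pose A := Num.sqrt (1 - cabs (lam l) ^+ 2).
have Apos : 0 < A by rewrite sqrtr_gt0.
have AE : A ^+ 2 = 1 - cabs (lam l) ^+ 2 by rewrite sqr_sqrtr// ltW.
have den j : 1 - lam l * conjc (lam j) != 0.
  by rewrite mulrC; exact: szego_den_neq0.
(* The rank-one term of the Blaschke identity evaluates [y] to [c]. *)
pose y j := c j * (1 - lam l * conjc (lam j)) / A%:C.
have AC : A%:C != 0 by rewrite fmorph_eq0 gt_eqF.
have yE : vector_form lam alpha t y =
    vector_form lam alpha t (fun j => blaschke lam (lam l) j * y j) +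
    \sum_(i < m) cabs (\sum_(j <- t) alpha i j * c j) ^+ 2.
  rewrite /vector_form -big_split/=; apply: eq_bigr => i _.
  rewrite (szego_form_blaschke lam_disc _ _ l1); congr (_ + _).
    by apply: eq_szego_form => j _; rewrite mulrCA.
  rewrite -AE (_ : \sum_(j <- t) _ = (\sum_(j <- t) alpha i j * c j) / A%:C).
    rewrite cabsM cabsV cabs_real ger0_norm ?(ltW Apos)// exprMn exprVn mulrCA.
    by rewrite mulfV ?mulr1// expf_neq0// gt_eqF.
  rewrite mulr_suml; apply: eq_bigr => j _; rewrite /y.
  by field; rewrite AC den.
have small : vector_form lam alpha t (fun j => blaschke lam (lam l) j * y j) <=
    c0 / 2 * diag_form t y.
  apply: (@le_trans _ _ (\sum_(i < m) 2 ^+ m.+1 * \sum_(j <- t) eta ^+ 2 *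
      (cabs (alpha i j) ^+ 2 * (cabs (y j) ^+ 2 / (1 - cabs (lam j) ^+ 2))))).
    apply: ler_sum => i _; apply: le_trans (szego_form_le_diag lam_disc _ _) _.
    apply: ler_pM; rewrite ?exprn_ge0//.
    - by apply: sumr_ge0 => j _; rewrite divr_ge0 ?sqr_ge0 ?disc_sub_ge0.
    - by apply: ler_weXn2l => //; rewrite ler1n.
    rewrite !big_seq; apply: ler_sum => j jt.
    rewrite (cabsM (alpha i j)) (cabsM (blaschke _ _ _)) !(exprMn _ (cabs _)).
    have perm (x b u v : R) : x * (b * u) * v = b * (x * (u * v)) by ring.
    rewrite perm ler_wpM2r//.
      by rewrite mulr_ge0 ?sqr_ge0// divr_ge0 ?sqr_ge0 ?disc_sub_ge0.
    rewrite cabs_blaschke// -pseudo_hyp_sqr// ler_sqr ?nnegrE ?pseudo_hyp_ge0//.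
    exact: near.
  rewrite -mulr_sumr exchange_big/=.
  under eq_bigr do rewrite -mulr_sumr -mulr_suml alpha_unit mul1r.
  by rewrite -mulr_sumr mulrA ler_wpM2r// diag_form_ge0.
have big : \sum_(j <- t) cabs (c j) ^+ 2 <= diag_form t y.
  apply: ler_sum => j _.
  rewrite (_ : _ / _ = cabs (c j) ^+ 2 / overlap (lam l) (lam j)); last first.
    rewrite /y !cabsM cabsV cabs_real ger0_norm ?(ltW Apos)// /overlap -AE.
    rewrite -[X in _ = _ / (_ / X ^+ 2)]cabs_conj conjcB conjcM conjc1 conjcK.
    have h1 : A != 0 by rewrite gt_eqF.
    have h2 : 1 - cabs (lam j) ^+ 2 != 0 by rewrite gt_eqF// disc_sub_gt0.
    have h3 : cabs (1 - lam l * conjc (lam j)) != 0 by rewrite cabs_eq0.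
    by field; rewrite h1 h2 h3.
  have o0 : 0 < overlap (lam l) (lam j).
    rewrite /overlap divr_gt0 ?(mulr_gt0 (disc_sub_gt0 _)) ?disc_sub_gt0//.
    by rewrite exprn_gt0// lt0r cabs_eq0 cabs_ge0 szego_den_neq0.
  rewrite ler_pdivlMr// ler_piMr ?sqr_ge0//.
  by rewrite -subr_ge0 -pseudo_hyp_sqr// sqr_ge0.
have := lower y; rewrite yE.
have : c0 / 2 * \sum_(j <- t) cabs (c j) ^+ 2 <= c0 / 2 * diag_form t y.
  by rewrite ler_wpM2l// divr_ge0// ltW.
by move: small; lra.
Qed.

Lemma linear_dependence (t : seq I) : (m < size t)%N -> uniq t ->
  exists2 c : I -> R[i], (exists2 j, j \in t & c j != 0) &
    forall i, \sum_(j <- t) alpha i j * c j = 0.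
Proof.
move=> mt ut.
pose M := \matrix_(k < size t, i < m) alpha i (tnth (in_tuple t) k).
have [v vM v0] : exists2 v : 'rV_(size t), v *m M = 0 & v != 0.
  have : kermx M != 0.
    rewrite -mxrank_eq0 mxrank_ker subn_eq0 -ltnNge.
    exact: leq_ltn_trans (rank_leq_col M) mt.
  case/rowV0Pn => v /sub_kermxP vM v0.
  by exists v.
pose c j : R[i] := \sum_(k < size t | tnth (in_tuple t) k == j) v 0 k.
have cE k : c (tnth (in_tuple t) k) = v 0 k.
  rewrite /c (big_pred1 k)// => k' /=.
  by apply/eqP/eqP => [|->//]; apply/tuple_uniqP.
exists c.
  have [k vk] : exists k, v 0 k != 0.
    apply/existsP; apply: contraNT v0; rewrite negb_exists => /forallP v0.
    by apply/eqP/rowP => k; rewrite mxE; apply/eqP; have := v0 k; rewrite negbK.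
  by exists (tnth (in_tuple t) k); [exact: mem_tnth|rewrite cE].
move=> i; rewrite big_tnth.
have := congr1 (fun N : 'rV_m => N 0 i) vM; rewrite !mxE => vMi.
by rewrite -[RHS]vMi; apply: eq_bigr => k _; rewrite cE mxE mulrC.
Qed.

Lemma local_condition_of_riesz : riesz -> exists eta D0 : R, local_condition eta D0.
Proof.
move=> [c0 [c1 [c00 c10 hr]]].
(* [2 ^ (m + 1)] is the constant of the crude diagonal bound for at most
   [m + 1] points; the bound [eta <= 1] replaces [eta ^ 2] by [eta]. *)
pose eta := Num.min (2^-1) (c0 / 2 / 2 ^+ m.+1).
have P0 : 0 < 2 ^+ m.+1 :> R by rewrite exprn_gt0.
have eta0 : 0 < eta by rewrite lt_min invr_gt0 ltr0n !divr_gt0.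
have eta1 : eta <= 2^-1 by rewrite ge_min lexx.
have etac : 2 ^+ m.+1 * eta ^+ 2 <= c0 / 2.
  have : eta <= c0 / 2 / 2 ^+ m.+1 by rewrite ge_min lexx orbT.
  rewrite ler_pdivlMr// mulrC => /(le_trans _); apply.
  by rewrite ler_pM2l// expr2 ler_piMl ?ltW//; lra.
have near l t c : uniq t -> (size t <= m.+1)%N ->
    (forall j, j \in t -> pseudo_ball (lam l) eta (lam j)) ->
    c0 / 2 * \sum_(j <- t) cabs (c j) ^+ 2 <=
    \sum_(i < m) cabs (\sum_(j <- t) alpha i j * c j) ^+ 2.
  move=> ut tm tl; apply: (local_lower_bound_of_riesz c (eta := eta) (l := l)) => //.
  - exact: ltW.
  - by move=> y; case/andP: (hr t y ut).
  - by move=> j /tl[_ /ltW].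
exists eta, (Num.sqrt (c0 / 2)); split.
- by rewrite eta0; lra.
- by rewrite sqrtr_gt0 divr_gt0.
- move=> l; apply: card_le_of_uniq => t ut tl; rewrite leqNgt; apply/negP => mt.
  have := near l (take m.+1 t).
  have [||c [j jt cj] c0'] := @linear_dependence (take m.+1 t).
  + by rewrite size_take_min leq_min ltnSn.
  + exact: take_uniq.
  move=> /(_ c (take_uniq _ ut)); rewrite size_take_min geq_minl => /(_ isT).
  have sub k : k \in take m.+1 t -> pseudo_ball (lam l) eta (lam k).
    by move=> /mem_take/tl.
  move=> /(_ sub); rewrite [leRHS]big1 => [|i _]; last by rewrite c0' cabs0 expr0n.
  rewrite pmulr_rle0 ?divr_gt0// leNgt => /negP; apply.
  rewrite (big_rem _ jt)/= ltr_pwDl//.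
    by rewrite exprn_gt0// lt0r cabs_eq0 cj cabs_ge0.
  by apply: sumr_ge0 => k _; exact: sqr_ge0.
- move=> l p js pm ujs jsl c.
  rewrite sqr_sqrtr; last by rewrite divr_ge0// ltW.
  pose c' j : R[i] := \sum_(k < p | tnth js k == j) c k.
  have c'E k : c' (tnth js k) = c k.
    rewrite /c' (big_pred1 k)// => k' /=.
    by apply/eqP/eqP => [|->//]; apply/tuple_uniqP.
  have := near l js c' ujs; rewrite size_tuple => /(_ (leqW pm)).
  have sub j : j \in tval js -> pseudo_ball (lam l) eta (lam j).
    move=> jjs; have : [set` js] j by [].
    by rewrite jsl.
  move=> /(_ sub); rewrite big_tuple; under eq_bigr do rewrite c'E.
  under [leRHS]eq_bigr do rewrite big_tuple.
  by under [leRHS]eq_bigr do under eq_bigr do rewrite c'E.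
Qed.

End riesz.

(** * From local independence to a Riesz sequence *)

Lemma big_uniq_inter (V : nmodType) (I : eqType) (s t : seq I) (f : I -> V) :
  uniq s -> uniq t -> (forall j, j \in s -> j \notin t -> f j = 0) ->
  \sum_(j <- s) f j = \sum_(j <- t) (if j \in s then f j else 0).
Proof.
move=> us ut f0; rewrite -big_mkcond/= -[RHS]big_filter.
rewrite [RHS](perm_big [seq j <- s | j \in t])/=; last first.
  apply: uniq_perm; rewrite ?filter_uniq// => j.
  by rewrite !mem_filter andbC.
rewrite big_filter [RHS]big_mkcond/=; apply: eq_big_seq => j js.
by case: ifPn => // jt; exact: f0.
Qed.

Section sufficiency.
Context {R : realType} {I : choiceType} (lam : I -> R[i]).
Context (m : nat) (alpha : 'I_m -> I -> R[i]).
Hypothesis lam_disc : forall j, disc R (lam j).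
Hypothesis alpha_unit : forall j, \sum_(i < m) cabs (alpha i j) ^+ 2 = 1.

(** Duality again: a partial sum of the form is the pairing of the
    coefficients with the values of the polynomial that has the Taylor
    coefficients of the combination as coefficients. *)
Lemma szego_form_bessel (C : R) (s : seq I) (z : I -> R[i]) : 0 < C ->
  (forall N (g : nat -> R[i]),
    \sum_(j <- s) (1 - cabs (lam j) ^+ 2) *
      cabs (\sum_(0 <= n < N) g n * lam j ^+ n) ^+ 2 <=
    C * \sum_(0 <= n < N) cabs (g n) ^+ 2) ->
  szego_form lam s z <= C * diag_form lam s z.
Proof.
move=> C0 hC.
apply: (ler_cvg_to (cvg_szego_form lam_disc (s := s) (z := z)) (cvg_cst _)).
apply: nearW => N; rewrite /series /=.
pose G n := \sum_(j <- s) z j * conjc (lam j) ^+ n.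
pose S := \sum_(0 <= n < N) cabs (G n) ^+ 2.
pose f j := \sum_(0 <= n < N) G n * lam j ^+ n.
have S0 : 0 <= S by apply: sumr_ge0 => n _; exact: sqr_ge0.
have SE : S%:C = \sum_(j <- s) z j * conjc (f j).
  rewrite /S (rmorph_sum (real_complex R)) /=.
  under [RHS]eq_bigr do rewrite conjc_sum mulr_sumr.
  rewrite exchange_big; apply: eq_bigr => n _ /=.
  rewrite cabs_sqrE [in LHS]/G mulr_suml; apply: eq_bigr => j _.
  by rewrite conjcM conjcX; ring.
suff : S <= (C * diag_form lam s z + S) / 2 by rewrite -/S; lra.
rewrite -[leLHS](ger0_norm S0) -cabs_real SE (le_trans (cabs_sum _ _))//.
apply: (@le_trans _ _ (\sum_(j <- s) (C * (cabs (z j) ^+ 2 / (1 - cabs (lam j) ^+ 2))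
    + C^-1 * ((1 - cabs (lam j) ^+ 2) * cabs (f j) ^+ 2)) / 2)).
  apply: ler_sum => j _; have w0 := disc_sub_gt0 (lam_disc j).
  rewrite cabsM cabs_conj.
  have t0 : 0 < C / (1 - cabs (lam j) ^+ 2) by rewrite divr_gt0.
  apply: le_trans (young_ineq _ _ t0) _; rewrite le_eqVlt; apply/orP; left.
  by apply/eqP; field; rewrite !gt_eqF.
rewrite -mulr_suml ler_wpM2r ?invr_ge0// big_split/= -!mulr_sumr lerD2l.
by rewrite ler_pdivrMl//; exact: hC.
Qed.

(** The indices of [s] near [l] may form only a part of the ball; the missing
    coefficients are set to zero. *)
Lemma local_independence_of_local_condition (eta D0 : R) (s : seq I) :
  local_condition lam alpha eta D0 -> uniq s ->
  forall l (w : I -> R[i]), l \in s ->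
  (forall j, j \in s -> eta <= pseudo_hyp (lam l) (lam j) -> w j = 0) ->
  D0 ^+ 2 * \sum_(j <- s) cabs (w j) ^+ 2 <=
  \sum_(i < m) cabs (\sum_(j <- s) alpha i j * w j) ^+ 2.
Proof.
move=> [_ _ b1 b2] us l w ls w0.
have [t [ut tm tE]] := (card_le_seqP _ _).1 (b1 l).
have w0' j : j \in s -> j \notin t -> w j = 0.
  move=> js jt; apply: w0 => //; rewrite leNgt; apply: contra jt => jl.
  have : (lam @^-1` pseudo_ball (lam l) eta) j by split; [exact: lam_disc|].
  by rewrite tE.
pose c (k : 'I_(size t)) : R[i] :=
  if tnth (in_tuple t) k \in s then w (tnth (in_tuple t) k) else 0.
have -> : \sum_(j <- s) cabs (w j) ^+ 2 = \sum_(k < size t) cabs (c k) ^+ 2.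
  rewrite (big_uniq_inter us ut) => [|j js jt]; last first.
    by rewrite w0'// cabs0 expr0n.
  rewrite [LHS]big_tnth; apply: eq_bigr => k _.
  by rewrite /c; case: ifP => // _; rewrite cabs0 expr0n.
apply: le_trans (b2 l (size t) (in_tuple t) tm ut (esym tE) c) _.
rewrite le_eqVlt; apply/orP; left; apply/eqP.
apply: eq_bigr => i _; congr (cabs _ ^+ 2).
rewrite (big_uniq_inter us ut); last by move=> j js jt; rewrite w0'// mulr0.
rewrite [RHS]big_tnth; apply: eq_bigr => k _.
by rewrite /c; case: ifP => // _; rewrite mulr0.
Qed.

Lemma riesz_of_local_condition (eta D0 : R) : carleson (eigen_measure lam) ->
  local_condition lam alpha eta D0 -> riesz lam alpha.
Proof.
move=> /(carleson_polynomial lam_disc)[C C0 hC] loc.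
have [/andP[eta0 eta1] D00 _ _] := loc.
(* [4 * C] bounds the sums of overlaps; the weights are the overlaps with the
   origin. *)
exists (D0 ^+ 2 * expR (- (4 * C / eta ^+ 2)) / 4 * expR (- (3 * (4 * C)))), C.
split=> // [|s y us].
  by rewrite !mulr_gt0 ?expR_gt0 ?invr_gt0.
apply/andP; split.
  apply: vector_form_lower => //.
  - by rewrite exprn_gt0.
  - exact: (local_independence_of_local_condition loc us).
  - by move=> l _; apply: carleson_overlap => // N g; exact: hC.
  have := carleson_overlap lam_disc C0 (@disc0 R) (fun N g => hC N g s us).
  apply: le_trans; apply: ler_sum => j _.
  by rewrite /overlap cabs0 expr0n subr0 mulr1 mulr0 subr0 cabs1 expr1n divr1.
have -> : C * diag_form lam s y =
    \sum_(i < m) C * diag_form lam s (fun j => alpha i j * y j).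
  rewrite -mulr_sumr exchange_big; congr (_ * _); apply: eq_bigr => j _ /=.
  under eq_bigr do rewrite cabsM exprMn -mulrA.
  by rewrite -mulr_suml alpha_unit mul1r.
by apply: ler_sum => i _; apply: szego_form_bessel => // N g; exact: hC.
Qed.

End sufficiency.

(** * Frames of orbits and Riesz sequences *)

Lemma esum_nat_ord (R : realType) (m : nat) (f : nat -> 'I_m -> R) :
  (forall n i, 0 <= f n i) ->
  \esum_(k in [set: nat * 'I_m]) (f k.1 k.2)%:E =
  \esum_(n in [set: nat]) (\sum_(i < m) f n i)%:E.
Proof.
move=> f0.
rewrite (_ : [set: nat * 'I_m] = [set: nat] `*`` (fun=> [set: 'I_m])); last first.
  by apply/seteqP; split.
rewrite -(@esum_esum _ _ _ _ _ (fun n i => (f n i)%:E)); last first.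
  by move=> *; rewrite lee_fin.
apply: eq_esum => n _; apply/le_anti/andP; split.
  apply: esum_le_seq => s us; rewrite sumEFin lee_fin.
  rewrite [leRHS](bigID (mem s))/= big_uniq// lerDl.
  by apply: sumr_ge0.
by rewrite -sumEFin; apply: seq_le_esum; exact: index_enum_uniq.
Qed.

Section orbits.
Context {R : realType} {I : choiceType} (lam : I -> R[i]).
Context (A : {linear ell2 R I -> ell2 R I}).
Hypotheses (bddA : bounded_op A) (diagA : diagonal_op A lam).
Context (m : nat) (a : 'I_m -> ell2 R I).
Implicit Types (x : ell2 R I) (s : seq I) (z y : I -> R[i]).

Let l2norm_ge0 x : 0 <= l2norm x. Proof. exact: sqrtr_ge0. Qed.

(** The hypothesis on the basis determines [A] because [A] is continuous. *)
Lemma diagonal_coord x j : A x j = lam j * x j.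
Proof.
have [M hM] := bddA.
apply/eqP; rewrite -subr_eq0 -cabs_eq0 -sqrf_eq0 eq_le sqr_ge0 andbT.
apply/ler_addgt0Pr => e e0; rewrite add0r.
have M0 : 0 < M ^+ 2 + 1 by rewrite ltr_wpDl ?sqr_ge0.
have [|s [us js se]] := l2norm_approx x [:: j] (e := e / (M ^+ 2 + 1)).
  by rewrite divr_gt0.
have {}js : j \in s by apply: js; rewrite mem_head.
have AE : A (finite_vector s x) = finite_vector s (fun k => lam k * x k).
  rewrite /finite_vector linear_sum; apply: eq_bigr => k _.
  by rewrite linearZ/= diagA scalerA mulrC.
have -> : A x j - lam j * x j = A (x - finite_vector s x) j.
  by rewrite linearB ell2B AE finite_vectorE// js.
apply: (@le_trans _ _ (l2norm (A (x - finite_vector s x)) ^+ 2)).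
  by have := @sum_le_l2norm R I (A (x - finite_vector s x)) [:: j] isT; rewrite big_seq1.
apply: (@le_trans _ _ (M ^+ 2 * l2norm (x - finite_vector s x) ^+ 2)).
  rewrite -exprMn ler_sqr ?nnegrE//; exact: le_trans (hM _).
apply: (@le_trans _ _ ((M ^+ 2 + 1) * (e / (M ^+ 2 + 1)))); last first.
  by rewrite mulrCA divff ?mulr1// gt_eqF.
by rewrite ler_pM ?sqr_ge0// lerDl.
Qed.

Lemma iter_coord n x j : iter n A x j = lam j ^+ n * x j.
Proof.
elim: n => [|n IHn]; first by rewrite expr0 mul1r.
by rewrite iterS diagonal_coord IHn exprS mulrA.
Qed.

Definition frame_sum x : \bar R :=
  \esum_(k in [set: nat * 'I_m]) (cabs (dot2 x (iter k.1 A (a k.2))) ^+ 2)%:E.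

Definition frame_partial N x : R :=
  \sum_(0 <= n < N) \sum_(i < m) cabs (dot2 x (iter n A (a i))) ^+ 2.

Lemma frame_sumE x : frame_sum x =
  \esum_(n in [set: nat])
    (\sum_(i < m) cabs (dot2 x (iter n A (a i))) ^+ 2)%:E.
Proof.
exact: (esum_nat_ord (f := fun n i => cabs (dot2 x (iter n A (a i))) ^+ 2)
  (fun n i => sqr_ge0 _)).
Qed.

Lemma frame_sum_le x (M : R) : (forall N, frame_partial N x <= M) ->
  (frame_sum x <= M%:E)%E.
Proof.
move=> hM; rewrite frame_sumE; apply: esum_le_series => // n.
by apply: sumr_ge0 => i _; exact: sqr_ge0.
Qed.

Lemma frame_partial_le x N : ((frame_partial N x)%:E <= frame_sum x)%E.
Proof. by rewrite frame_sumE; exact: esum_ge_series. Qed.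

Lemma dot2_iter_finite s z n i :
  dot2 (finite_vector s z) (iter n A (a i)) =
  \sum_(j <- s) z j * conjc (a i j) * conjc (lam j) ^+ n.
Proof.
rewrite dot2_finite_vector; apply: eq_bigr => j _.
by rewrite iter_coord conjcM conjcX; ring.
Qed.

Lemma frame_sum_finite s z : (forall j, disc R (lam j)) ->
  frame_sum (finite_vector s z) =
  (\sum_(i < m) szego_form lam s (fun j => z j * conjc (a i j)))%:E.
Proof.
move=> lam_disc.
have c : (fun N => frame_partial N (finite_vector s z)) @ \oo -->
    \sum_(i < m) szego_form lam s (fun j => z j * conjc (a i j)).
  rewrite (_ : (fun N => _) = (fun N => \sum_(i < m) series (fun n =>
      cabs (\sum_(j <- s) z j * conjc (a i j) * conjc (lam j) ^+ n) ^+ 2) N)).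
    by apply: cvg_finite_sum => i; exact: cvg_szego_form.
  apply/funext => N; rewrite /frame_partial exchange_big; apply: eq_bigr => i _.
  by apply: eq_bigr => n _; rewrite dot2_iter_finite.
rewrite frame_sumE -nneseries_esumT; last first.
  by move=> n; rewrite lee_fin; apply: sumr_ge0 => i _; exact: sqr_ge0.
rewrite (_ : (fun N => _) = EFin \o (fun N => frame_partial N (finite_vector s z))).
  by apply/cvg_lim => //; apply/cvg_EFin => //; exact: nearW.
by apply/funext => N /=; rewrite sumEFin.
Qed.

Lemma frame_sumD x x' :
  (frame_sum (x + x')%R <= 2%:E * frame_sum x + 2%:E * frame_sum x')%E.
Proof.
have sq0 (u : ell2 R I) (k : nat * 'I_m) :
    (0 <= (cabs (dot2 u (iter k.1 A (a k.2))) ^+ 2)%:E)%E.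
  by rewrite lee_fin sqr_ge0.
rewrite /frame_sum -!ge0_esumZl// -esumD; last 2 first.
- by move=> k _; rewrite mule_ge0 ?sq0.
- by move=> k _; rewrite mule_ge0 ?sq0.
by apply: le_esum => k _; rewrite dot2D -!EFinM -EFinD lee_fin cabs_sqrD.
Qed.

Lemma frame_partialD N x x' :
  frame_partial N (x + x') <= 2 * frame_partial N x + 2 * frame_partial N x'.
Proof.
rewrite /frame_partial !mulr_sumr -big_split; apply: ler_sum => n _.
rewrite !mulr_sumr -big_split; apply: ler_sum => i _.
by rewrite dot2D; exact: cabs_sqrD.
Qed.

Lemma frame_partial_bounded N : exists2 M : R, 0 <= M &
  forall x (t : R), 0 < t -> l2norm x ^+ 2 <= t -> frame_partial N x <= M * t.
Proof.
have /choice[M hM] (k : nat * 'I_m) : exists M : R, 0 <= M /\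
    forall x (t : R), 0 < t -> l2norm x ^+ 2 <= t ->
      cabs (dot2 x (iter k.1 A (a k.2))) ^+ 2 <= M * t.
  by have [M] := dot2_bounded (iter k.1 A (a k.2)); exists M.
exists (\sum_(0 <= n < N) \sum_(i < m) M (n, i)).
  by apply: sumr_ge0 => n _; apply: sumr_ge0 => i _; case: (hM (n, i)).
move=> x t t0 xt; rewrite mulr_suml; apply: ler_sum => n _.
by rewrite mulr_suml; apply: ler_sum => i _; apply: (hM (n, i)).2.
Qed.

Let l2normD x x' : l2norm (x + x') ^+ 2 <= 2 * l2norm x ^+ 2 + 2 * l2norm x' ^+ 2.
Proof.
rewrite -lee_fin EFinD (EFinM _ (l2norm x ^+ 2)) (EFinM _ (l2norm x' ^+ 2)).
rewrite !l2norm_sqrE; apply: sqsum_le => // j.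
exact: cabs_sqrD.
Qed.

Let l2normN x : l2norm (- x) = l2norm x.
Proof.
rewrite /l2norm; congr (Num.sqrt (fine _)); apply: eq_esum => j _.
by rewrite -[(- x) j]/(- x j) cabsN.
Qed.

Let split_vector x s : x = finite_vector s x + (x - finite_vector s x).
Proof. by rewrite addrC subrK. Qed.

(** Both frame bounds extend from finitely supported vectors by truncation.
    The upper bound comes first: a partial sum involves finitely many
    continuous functionals, so the truncation error is negligible there.  The
    upper bound then controls the full frame sum of the truncation error in the
    proof of the lower bound.  The factors lost come from
    [|u + v|^2 <= 2 |u|^2 + 2 |v|^2]. *)
Lemma frame_of_finite (c0 c1 : R) : 0 < c0 -> 0 < c1 ->
  (forall s z, uniq s ->
    ((c0 * l2norm (finite_vector s z) ^+ 2)%:E <= frame_sum (finite_vector s z))%E /\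
    (frame_sum (finite_vector s z) <= (c1 * l2norm (finite_vector s z) ^+ 2)%:E)%E) ->
  is_frame (fun k : nat * 'I_m => iter k.1 A (a k.2)).
Proof.
move=> c00 c10 hfin.
have finite_le x s : uniq s -> l2norm (finite_vector s x) ^+ 2 <= l2norm x ^+ 2.
  by move=> us; rewrite l2norm_finite_vector// sum_le_l2norm.
have upper x : (frame_sum x <= (2 * c1 * l2norm x ^+ 2)%:E)%E.
  apply: frame_sum_le => N; apply/ler_addgt0Pr => e e0.
  have [M M0 hM] := frame_partial_bounded N.
  have M1 : 0 < 2 * M + 1 by rewrite ltr_wpDl// mulr_ge0.
  have e1 : 0 < e / (2 * M + 1) by rewrite divr_gt0.
  have [s [us _ se]] := l2norm_approx x [::] e1.
  rewrite {1}(split_vector x s) (le_trans (frame_partialD _ _ _))// lerD//.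
    rewrite -mulrA ler_pM2l// -lee_fin; apply: le_trans (frame_partial_le _ _) _.
    apply: le_trans (hfin s x us).2 _.
    by rewrite lee_fin ler_pM2l// finite_le.
  apply: (@le_trans _ _ (2 * (M * (e / (2 * M + 1))))).
    by rewrite ler_pM2l// hM.
  rewrite mulrA -[leRHS](mulfVK (_ : 2 * M + 1 != 0)) ?gt_eqF//.
  by rewrite [leRHS]mulrC ler_wpM2r ?lerDl// ltW.
have lower x : ((c0 / 4 * l2norm x ^+ 2)%:E <= frame_sum x)%E.
  have Tfin : frame_sum x \is a fin_num.
    rewrite ge0_fin_numE; first exact: le_lt_trans (upper x) (ltry _).
    by apply: esum_ge0 => k _; rewrite lee_fin sqr_ge0.
  have [T TE] : exists T, frame_sum x = T%:E by exists (fine (frame_sum x)); rewrite fineK.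
  rewrite TE lee_fin; apply/ler_addgt0Pr => e e0.
  pose B := 2 * c1 + c0 / 2.
  have B0 : 0 < B by rewrite addr_gt0 ?mulr_gt0 ?divr_gt0.
  have e1 : 0 < e / B by rewrite divr_gt0.
  have [s [us _ se]] := l2norm_approx x [::] e1.
  have h1 := (hfin s x us).1.
  have h2 : (frame_sum (finite_vector s x) <=
      2%:E * frame_sum x + 2%:E * (2 * c1 * (e / B))%:E)%E.
    rewrite {1}(_ : finite_vector s x = x + - (x - finite_vector s x)); last first.
      by rewrite opprB addrC subrK.
    apply: le_trans (frame_sumD _ _) _; rewrite leeD2l// lee_wpmul2l//.
    apply: le_trans (upper _) _; rewrite lee_fin ler_wpM2l ?mulr_ge0 ?(ltW c10)//.
    by rewrite l2normN.
  move: h2; rewrite TE -!EFinM -EFinD => h2.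
  have := le_trans h1 h2; rewrite lee_fin => h.
  have h3 := l2normD (finite_vector s x) (x - finite_vector s x).
  rewrite -split_vector in h3.
  have BE : B * (e / B) = e by rewrite mulrCA divff ?mulr1// gt_eqF.
  move: BE h h3 se; rewrite /B; move: (e / _) => q.
  move: (l2norm x ^+ 2) (l2norm (finite_vector s x) ^+ 2)
    (l2norm (x - finite_vector s x) ^+ 2).
  move=> X F G BE h h3 se.
  have : c0 * X <= c0 * (2 * F + 2 * G) by rewrite ler_pM2l.
  have : c0 * G <= c0 * q by rewrite ler_pM2l.
  by lra.
exists (c0 / 4), (c0 / 4 + 2 * c1); split.
- by rewrite divr_gt0.
- by rewrite lerDl mulr_ge0// ltW.
move=> x; split; first exact: lower.
apply: le_trans (upper x) _; rewrite lee_fin ler_wpM2r ?sqr_ge0// lerDr.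
by rewrite divr_ge0// ltW.
Qed.

End orbits.

Section frame_normal_form.
Context {R : realType} {I : choiceType} (lam : I -> R[i]).
Context (A : {linear ell2 R I -> ell2 R I}).
Hypotheses (bddA : bounded_op A) (diagA : diagonal_op A lam).
Context (m : nat) (a : 'I_m -> ell2 R I).
Implicit Types (x : ell2 R I) (s : seq I) (z y : I -> R[i]).

Section normalisation.
Hypothesis lam_disc : forall j, disc R (lam j).
Context (C : R) (d : I -> R) (alpha : 'I_m -> I -> R[i]).
Hypotheses (C_ge1 : 1 <= C) (d_bounds : forall j, C^-1 <= d j <= C).
Hypothesis aE : forall i j, a i j =
  (d j)%:C * conjc (alpha i j) * (Num.sqrt (1 - cabs (lam j) ^+ 2))%:C.

Let C_gt0 : 0 < C. Proof. exact: lt_le_trans C_ge1. Qed.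

Let d_gt0 j : 0 < d j.
Proof.
by case/andP: (d_bounds j) => h _; apply: lt_le_trans h; rewrite invr_gt0.
Qed.

(** Passes from the coordinates of a vector to the coefficients of the
    unnormalised kernels. *)
Let rescale z j : R[i] := (d j * Num.sqrt (1 - cabs (lam j) ^+ 2))%:C * z j.

Let frame_sum_rescale s z :
  frame_sum A a (finite_vector s z) = (vector_form lam alpha s (rescale z))%:E.
Proof.
rewrite (frame_sum_finite bddA diagA)//; congr EFin; apply: eq_bigr => i _.
apply: eq_szego_form => j _.
by rewrite aE !conjcM !conjc_real conjcK /rescale rmorphM/=; ring.
Qed.

Let diag_form_rescale s z :
  diag_form lam s (rescale z) = \sum_(j <- s) d j ^+ 2 * cabs (z j) ^+ 2.
Proof.
apply: eq_bigr => j _; have w0 := disc_sub_gt0 (lam_disc j).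
rewrite cabsM cabs_real ger0_norm ?mulr_ge0 ?sqrtr_ge0 ?(ltW (d_gt0 j))//.
rewrite !exprMn sqr_sqrtr ?(ltW w0)//.
by field; rewrite gt_eqF.
Qed.

Let norm_bounds s z : uniq s ->
  diag_form lam s (rescale z) / C ^+ 2 <= l2norm (finite_vector s z) ^+ 2 <=
  C ^+ 2 * diag_form lam s (rescale z).
Proof.
move=> us; rewrite l2norm_finite_vector// diag_form_rescale mulr_suml mulr_sumr.
apply/andP; split; apply: ler_sum => j _; case/andP: (d_bounds j) => dl du.
  rewrite ler_pdivrMr ?exprn_gt0// mulrC ler_wpM2l ?sqr_ge0//.
  by rewrite ler_sqr ?nnegrE// ltW.
rewrite mulrA -exprMn ler_peMl ?sqr_ge0// exprn_ege1//.
by rewrite -(divff (lt0r_neq0 C_gt0)) ler_pM2l.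
Qed.

Lemma frame_of_riesz : riesz lam alpha ->
  is_frame (fun k : nat * 'I_m => iter k.1 A (a k.2)).
Proof.
move=> [c0 [c1 [c00 c10 hr]]].
have C20 : 0 < C ^+ 2 by rewrite exprn_gt0.
apply: (@frame_of_finite _ _ A _ a (c0 / C ^+ 2) (c1 * C ^+ 2)).
- by rewrite divr_gt0.
- by rewrite mulr_gt0.
move=> s z us; rewrite frame_sum_rescale !lee_fin.
have /andP[h1 h2] := hr s (rescale z) us.
have /andP[n1 n2] := norm_bounds z us.
split.
  apply: le_trans h1; rewrite -mulrA ler_pM2l// ler_pdivrMl//.
apply: le_trans h2 _; rewrite -mulrA ler_pM2l// mulrC -ler_pdivrMr//.
Qed.

Lemma riesz_of_frame : is_frame (fun k : nat * 'I_m => iter k.1 A (a k.2)) ->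
  riesz lam alpha.
Proof.
move=> [c0 [c1 [c00 c01 hf]]].
have c10 : 0 < c1 by exact: lt_le_trans c01.
have C20 : 0 < C ^+ 2 by rewrite exprn_gt0.
exists (c0 / C ^+ 2), (c1 * C ^+ 2); split.
- by rewrite divr_gt0.
- by rewrite mulr_gt0.
move=> s y us.
pose z j := y j / (d j * Num.sqrt (1 - cabs (lam j) ^+ 2))%:C.
have zy : rescale z = y.
  apply/funext => j; rewrite /rescale /z mulrC divfK//.
  by rewrite fmorph_eq0 gt_eqF// mulr_gt0// sqrtr_gt0 disc_sub_gt0.
have := hf (finite_vector s z).
rewrite -/(frame_sum A a (finite_vector s z)) frame_sum_rescale !lee_fin.
have /andP[n1 n2] := norm_bounds z us; rewrite zy in n1 n2 *.
move=> [h1 h2]; apply/andP; split.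
  by apply: le_trans h1; rewrite -mulrA ler_pM2l// mulrC.
by apply: le_trans h2 _; rewrite -mulrA ler_pM2l.
Qed.

End normalisation.

Hypothesis frameA : is_frame (fun k : nat * 'I_m => iter k.1 A (a k.2)).

Let norm_sum j := \sum_(i < m) cabs (a i j) ^+ 2.

Let basis_partial j N :
  frame_partial A a N (finite_vector [:: j] (fun=> 1)) =
  \sum_(0 <= n < N) norm_sum j * (cabs (lam j) ^+ 2) ^+ n.
Proof.
apply: eq_bigr => n _; rewrite mulr_suml; apply: eq_bigr => i _.
rewrite (dot2_iter_finite bddA diagA) big_seq1 mul1r cabsM exprMn cabs_conj.
by rewrite cabsX cabs_conj exprAC.
Qed.

Let basis_bounds : exists c0 c1 : R, [/\ 0 < c0, c0 <= c1 & forall j,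
  (c0%:E <= frame_sum A a (finite_vector [:: j] (fun=> 1%R)) <= c1%:E)%E].
Proof.
have [c0 [c1 [c00 c01 hf]]] := frameA; exists c0, c1; split=> // j.
have := hf (finite_vector [:: j] (fun=> 1)).
rewrite l2norm_finite_vector// big_seq1 cabs1 expr1n !mulr1.
by move=> [h1 h2]; apply/andP.
Qed.

Let norm_sum_gt0 j : 0 < norm_sum j.
Proof.
have n0 : 0 <= norm_sum j by apply: sumr_ge0 => i _; exact: sqr_ge0.
rewrite lt0r n0 andbT; apply/eqP => z0.
have [c0 [c1 [c00 _ /(_ j)/andP[h _]]]] := basis_bounds.
have : (c0%:E <= 0%:E)%E.
  apply: le_trans h _; apply: frame_sum_le => N.
  by rewrite basis_partial z0 big1// => n _; rewrite mul0r.
by rewrite lee_fin leNgt c00.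
Qed.

(** Otherwise the orbit coefficients of a basis vector would not be square
    summable. *)
Lemma frame_disc j : disc R (lam j).
Proof.
rewrite discE ltNge; apply/negP => l1.
have [c0 [c1 [c00 c01 /(_ j)/andP[_ h]]]] := basis_bounds.
have c10 : 0 <= c1 by apply: le_trans c01; exact: ltW.
pose N := Num.bound (c1 / norm_sum j).
have : c1 / norm_sum j < N%:R.
  by apply: archi_boundP; rewrite divr_ge0 ?(ltW (norm_sum_gt0 j)).
rewrite ltr_pdivrMr// ltNge => /negP; apply.
rewrite -lee_fin; apply: le_trans h.
apply: le_trans (frame_partial_le A a _ N); rewrite lee_fin basis_partial.
apply: (@le_trans _ _ (\sum_(0 <= n < N) norm_sum j)).
  by rewrite sumr_const_nat subn0 mulr_natl.
apply: ler_sum => n _.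
by apply: ler_peMr; [exact: ltW|exact: exprn_ege1].
Qed.

Let frame_norm_bounds : exists c0 c1 : R, [/\ 0 < c0, c0 <= c1 & forall j,
  c0 <= norm_sum j / (1 - cabs (lam j) ^+ 2) <= c1].
Proof.
have [c0 [c1 [c00 c01 hf]]] := basis_bounds; exists c0, c1; split=> // j.
have := hf j; rewrite (frame_sum_finite bddA diagA _ _ _ frame_disc) !lee_fin.
rewrite (_ : \sum_(i < m) _ = norm_sum j / (1 - cabs (lam j) ^+ 2))//.
rewrite mulr_suml; apply: eq_bigr => i _.
by rewrite (szego_form1 lam) mul1r cabs_conj.
Qed.

(** The unit condition on [alpha] leaves only one choice for [d j], and the
    bounds on it are the frame inequalities for the basis vector of index
    [j]. *)
Lemma frame_normalisation : exists (C : R) (d : I -> R) (alpha : 'I_m -> I -> R[i]),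
  [/\ 1 <= C,
      forall j, C^-1 <= d j <= C,
      forall j, \sum_(i < m) cabs (alpha i j) ^+ 2 = 1 &
      forall i j, a i j =
        (d j)%:C * conjc (alpha i j) * (Num.sqrt (1 - cabs (lam j) ^+ 2))%:C].
Proof.
have [c0 [c1 [c00 c01 hb]]] := frame_norm_bounds.
have c10 : 0 < c1 by exact: lt_le_trans c01.
pose d j := Num.sqrt (norm_sum j / (1 - cabs (lam j) ^+ 2)).
pose w j := Num.sqrt (1 - cabs (lam j) ^+ 2).
have w0 j : 0 < w j by rewrite sqrtr_gt0 disc_sub_gt0//; exact: frame_disc.
have d0 j : 0 < d j.
  by rewrite sqrtr_gt0 divr_gt0// disc_sub_gt0//; exact: frame_disc.
have dw0 j : (d j * w j)%:C != 0 by rewrite fmorph_eq0 gt_eqF// mulr_gt0.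
pose C := 1 + Num.sqrt c1 + (Num.sqrt c0)^-1.
have C1 : 1 <= C by rewrite /C -addrA lerDl addr_ge0 ?invr_ge0 ?sqrtr_ge0.
exists C, d, (fun i j => conjc (a i j) / (d j * w j)%:C); split => //.
- move=> j; have /andP[b0 b1] := hb j; apply/andP; split.
    apply: (@le_trans _ _ (Num.sqrt c0)); last first.
      exact: ler_wsqrtr.
    rewrite -[leRHS]invrK lef_pV2 ?posrE.
    + by rewrite /C lerDr addr_ge0 ?sqrtr_ge0.
    + exact: lt_le_trans C1.
    + by rewrite invr_gt0 sqrtr_gt0.
  apply: (@le_trans _ _ (Num.sqrt c1)); first exact: ler_wsqrtr.
  by rewrite /C addrAC lerDr addr_ge0 ?invr_ge0 ?sqrtr_ge0.
- move=> j; under eq_bigr do rewrite cabsM cabs_conj cabsV exprMn.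
  rewrite -mulr_suml -/(norm_sum j) cabs_real ger0_norm ?mulr_ge0 ?(ltW (d0 j)) ?(ltW (w0 j))//.
  have l0 := disc_sub_gt0 (frame_disc j).
  rewrite exprVn exprMn !sqr_sqrtr ?(ltW l0)//; last by rewrite divr_ge0// ltW.
  by field; rewrite !gt_eqF.
- move=> i j; rewrite conjcM conjcK conjc_inv conjc_real mulrAC -rmorphM/=.
  by rewrite mulrC divfK.
Qed.

End frame_normal_form.

Theorem theorem3p5 (R : realType) (J : set nat)
    (hJ : J = [set: nat] \/ exists N : nat, J = `I_N)
    (lam : J -> R[i])
    (A : {linear ell2 R J -> ell2 R J})
    (bddA : bounded_op A) (diagA : diagonal_op A lam)
    (m : nat) (hm : (1 <= m)%N) (a : 'I_m -> ell2 R J) :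
  is_frame (fun k : nat * 'I_m => iter k.1 A (a k.2)) <->
  (forall j, disc R (lam j)) /\
  exists (C : R) (d : J -> R) (alpha : 'I_m -> J -> R[i]),
    (* (a) *)
    [/\ 1 <= C,
        forall j, C^-1 <= d j <= C,
        forall j, \sum_(i < m) cabs (alpha i j) ^+ 2 = 1 &
        forall i j, a i j =
          (d j)%:C * conjc (alpha i j) * (Num.sqrt (1 - cabs (lam j) ^+ 2))%:C]
    /\
    (* (b) *)
    carleson (eigen_measure lam) /\
    exists eta D0 : R,
      [/\ 0 < eta < 1,
          0 < D0,
          (* (b1) *)
          forall j, (lam @^-1` pseudo_ball (lam j) eta #<= `I_m)%card &
          (* (b2) *)
          forall (j1 : J) (p : nat) (js : p.-tuple J), (p <= m)%N -> uniq js ->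
            [set` js] = lam @^-1` pseudo_ball (lam j1) eta ->
            forall c : 'I_p -> R[i],
              D0 ^+ 2 * \sum_(s < p) cabs (c s) ^+ 2 <=
              \sum_(i < m) cabs (\sum_(s < p) alpha i (tnth js s) * c s) ^+ 2].
Proof.
split=> [frameA|[lam_disc [C [d [alpha [[C1 dC au aE] [carl [eta [D0 loc]]]]]]]]].
  have lam_disc := frame_disc bddA diagA frameA.
  have [C [d [alpha [C1 dC au aE]]]] := frame_normalisation bddA diagA frameA.
  have hr := riesz_of_frame bddA diagA lam_disc C1 dC aE frameA.
  split=> //; exists C, d, alpha; split=> //; split.
    exact: carleson_of_riesz lam_disc au hr.
  exact: local_condition_of_riesz lam_disc au hr.
apply: (frame_of_riesz bddA diagA lam_disc C1 dC aE).
exact: (riesz_of_local_condition lam_disc au carl loc).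
Qed.
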